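(* Let $X$ be a separable Banach space. If $X^*$ has Property($M^*$), then the following are equivalent. (a) $X$ is reflexive. (b) $\ell_1 \not\hookrightarrow X^*$, i.e. $X^*$ contains no subspace isomorphic to $\ell_1$. (c) $c_0 \not\hookrightarrow X$, i.e. $X$ contains no subspace isomorphic to $c_0$. (d) $X$ has the FPP (Fixed Point Property). (e) $X^*$ has the FPP.
   Context: Property($M^*$): the dual $X^*$ has Property($M^*$) if whenever $(x_n^* )$ is a sequence in $X^*$ converging weak* to $0$ (with respect to the predual $X$) and $u^*, v^* \in X^*$ satisfy $\|u^*\| \leq \|v^*\|$, then $\limsup_{n\to\infty}\|x_n^*+u^*\| \leq \limsup_{n\to\infty}\|x_n^*+v^*\|$. Fixed Point Property (FPP): a Banach space $Y$ has the FPP if for every nonempty closed bounded convex subset $C$ of $Y$, every nonexpansive map $T: C \to C$ (i.e. $\|Tx - Ty\| \leq \|x-y\|$ for all $x,y\in C$) has a fixed point. *)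

(* Defs.v *)
From HB Require Import structures.
From mathcomp Require Import all_boot all_order all_algebra.
From mathcomp Require Import all_classical all_reals all_analysis.

Set Implicit Arguments.
Unset Strict Implicit.
Unset Printing Implicit Defensive.

Import Order.TTheory GRing.Theory Num.Theory.
Import numFieldNormedType.Exports.

Local Open Scope classical_set_scope.
Local Open Scope ring_scope.

(* The scalar field is real throughout. *)

Section dual_lmodule.
Context {R : realType} (X : normedModType R).

Definition dual_pred : {pred X -> R^o} :=
  mem [set f : X -> R^o | linear f /\ continuous f].

Record dual : Type :=
  Dual { dual_fun :> X -> R^o ; dual_funP : dual_fun \in dual_pred }.

HB.instance Definition _ := [isSub for dual_fun].
HB.instance Definition _ := [Choice of dual by <:].

Lemma dual_linear (f : dual) : linear f.
Proof. by case: f => f /= /[!inE] -[]. Qed.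

HB.instance Definition _ (f : dual) :=
  GRing.isLinear.Build R X R^o *:%R f (dual_linear f).

Lemma dual_continuous (f : dual) : continuous f.
Proof. by case: f => f /= /[!inE] -[]. Qed.

Lemma dual_submod_closed : submod_closed dual_pred.
Proof.
split.
  rewrite inE; split => [a x y|]; first by rewrite scaler0 addr0.
  exact: cst_continuous.
move=> a f g /[!inE] -[lf cf] [lg cg]; split=> [b x y|x].
  rewrite !fctE lf lg !scalerDr !scalerA (mulrC a) -!addrA; congr (_ + _).
  by rewrite addrCA.
apply: (@continuousD R R^o X (fun x => a *: f x) g x _ (cg x)).
by apply: continuousZl_tmp; exact: cf.
Qed.

HB.instance Definition _ :=
  GRing.isSubmodClosed.Build R (X -> R^o) dual_pred dual_submod_closed.
HB.instance Definition _ := [SubChoice_isSubLmodule of dual by <:].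

Lemma dualDE (f g : dual) x : (f + g) x = f x + g x. Proof. by []. Qed.

Lemma dualZE a (f : dual) x : (a *: f) x = a * f x. Proof. by []. Qed.

Lemma dualP (f g : dual) : f =1 g -> f = g.
Proof. by move=> fg; apply/val_inj/funext. Qed.

End dual_lmodule.

Section dual_normed.
Context {R : realType} (X : normedModType R).
Implicit Types f g : dual X.

Definition dual_norm f : R := sup [set `|f x| | x in [set x | `|x| <= 1]].

Lemma dual_has_sup f : has_sup [set `|f x| | x in [set x : X | `|x| <= 1]].
Proof.
split; first by exists `|f 0|, 0 => //=; rewrite normr0.
have /linear_bounded_continuous/bounded_funP/(_ 1)[M fM] :
  continuous (f : {linear X -> R^o}) by exact: dual_continuous.
by exists M => _ [x /= x1 <-]; exact: fM.
Qed.

Lemma ler_dual_norm f x : `|f x| <= dual_norm f * `|x|.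
Proof.
have [->|x0] := eqVneq x 0; first by rewrite linear0 !normr0 mulr0.
have -> : `|f x| = `|f (`|x|^-1 *: x)| * `|x|.
  by rewrite linearZ normrZ normfV normr_id mulrAC mulVf ?mul1r ?normr_eq0.
apply: ler_wpM2r => //.
apply: sup_upper_bound; first exact: dual_has_sup.
exists (`|x|^-1 *: x) => //=.
by rewrite normrZ normfV normr_id mulVf ?normr_eq0.
Qed.

Lemma dual_norm_le f (M : R) :
  (forall x, `|x| <= 1 -> `|f x| <= M) -> dual_norm f <= M.
Proof.
move=> fM; apply: ge_sup; first by case: (dual_has_sup f).
by move=> _ [x /= x1 <-]; exact: fM.
Qed.

Lemma dual_norm_ge0 f : 0 <= dual_norm f.
Proof.
apply: le_trans (sup_upper_bound (dual_has_sup f) (x := `|f 0|) _) => //.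
by exists 0 => //=; rewrite normr0.
Qed.

Lemma ler_dual_norm1 f x : `|x| <= 1 -> `|f x| <= dual_norm f.
Proof.
move=> x1; apply: le_trans (ler_dual_norm f x) _.
by rewrite ler_piMr ?dual_norm_ge0.
Qed.

Lemma ler_dual_normD f g : dual_norm (f + g) <= dual_norm f + dual_norm g.
Proof.
apply: dual_norm_le => x x1; rewrite dualDE (le_trans (ler_normD _ _))//.
by rewrite lerD// ler_dual_norm1.
Qed.

Lemma dual_normZ (a : R) f : dual_norm (a *: f) = `|a| * dual_norm f.
Proof.
have le b g : dual_norm (b *: g) <= `|b| * dual_norm g.
  apply: dual_norm_le => x x1.
  by rewrite dualZE normrM ler_wpM2l// ler_dual_norm1.
apply/eqP; rewrite eq_le le/=.
have [->|a0] := eqVneq a 0; first by rewrite normr0 mul0r dual_norm_ge0.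
rewrite -ler_pdivlMl ?normr_gt0// -normfV.
by rewrite -{1}[f]scale1r -(mulVf a0) -scalerA le.
Qed.

Lemma dual_norm0_eq0 f : dual_norm f = 0 -> f = 0.
Proof.
move=> f0; apply: dualP => x; apply/normr0_eq0/le_anti.
by rewrite normr_ge0 andbT (le_trans (ler_dual_norm f x))// f0 mul0r.
Qed.

HB.instance Definition _ := Lmodule_isNormed.Build R (dual X)
  ler_dual_normD dual_normZ dual_norm0_eq0.

Lemma dual_normE f : `|f| = dual_norm f. Proof. by []. Qed.

End dual_normed.

Section ell1.
Context (R : realType).

Definition ell1_pred : {pred nat -> R^o} :=
  mem [set u : nat -> R^o | cvgn (series (fun n => `|u n|))].

Record ell1 : Type :=
  Ell1 { ell1_fun :> nat -> R^o ; ell1_funP : ell1_fun \in ell1_pred }.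

HB.instance Definition _ := [isSub for ell1_fun].
HB.instance Definition _ := [Choice of ell1 by <:].

Lemma ell1_cvg (u : ell1) : cvgn (series (fun n => `|u n|)).
Proof. by case: u => u /= /[!inE]. Qed.

Lemma ell1_submod_closed : submod_closed ell1_pred.
Proof.
split.
  rewrite inE/= (_ : series _ = cst 0); first exact: is_cvg_cst.
  by apply/funext => n; rewrite /series/= big1// => i _; rewrite normr0.
move=> a u v /[!inE]/= cu cv.
apply: (@series_le_cvg _ _ (fun n => `|a| * `|u n| + `|v n|)) => [n|n|n|].
- exact: normr_ge0.
- by rewrite addr_ge0// mulr_ge0.
- by rewrite !fctE (le_trans (ler_normD _ _))// normrM.
have -> : series (fun n => `|a| * `|u n| + `|v n|) =
    cst `|a| \* series (fun n => `|u n|) \+ series (fun n => `|v n|).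
  by apply/funext => n; rewrite /series/= big_split/= mulr_sumr.
by apply: is_cvgD => //; apply: is_cvgM => //; exact: is_cvg_cst.
Qed.

HB.instance Definition _ :=
  GRing.isSubmodClosed.Build R (nat -> R^o) ell1_pred ell1_submod_closed.
HB.instance Definition _ := [SubChoice_isSubLmodule of ell1 by <:].

Definition ell1_norm (u : ell1) : R := limn (series (fun n => `|u n|)).

Lemma ler_ell1_normD u v : ell1_norm (u + v) <= ell1_norm u + ell1_norm v.
Proof.
rewrite /ell1_norm -limD; [|exact: ell1_cvg..].
apply: ler_lim; [exact: ell1_cvg|by apply: is_cvgD; exact: ell1_cvg|].
near=> n; rewrite !fctE /series/= -big_split/=.
by apply: ler_sum => i _; exact: ler_normD.
Unshelve. all: by end_near. Qed.

Lemma ell1_normZ (a : R) u : ell1_norm (a *: u) = `|a| * ell1_norm u.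
Proof.
have -> : ell1_norm (a *: u) = limn (cst `|a| \* series (fun n => `|u n|)).
  congr (limn _); apply/funext => n; rewrite /series/= mulr_sumr.
  by apply: eq_bigr => i _; rewrite [LHS]normrZ.
rewrite limM ?lim_cst//; last exact: ell1_cvg.
exact: cvg_cst.
Qed.

Lemma ell1_norm0_eq0 u : ell1_norm u = 0 -> u = 0.
Proof.
move=> u0; apply/val_inj/funext => n; apply/normr0_eq0/le_anti.
rewrite normr_ge0 andbT -u0.
apply: (@le_trans _ _ (series (fun n => `|u n|) n.+1)).
  by rewrite /series/= big_nat_recr//= lerDr sumr_ge0.
apply: nondecreasing_cvgn_le; last exact: ell1_cvg.
by apply: nondecreasing_series => i _ _; exact: normr_ge0.
Qed.

HB.instance Definition _ := Lmodule_isNormed.Build R ell1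
  ler_ell1_normD ell1_normZ ell1_norm0_eq0.

End ell1.

Section c0.
Context (R : realType).

Definition c0_pred : {pred nat -> R^o} :=
  mem [set u : nat -> R^o | u n @[n --> \oo] --> (0 : R^o)].

Record c0 : Type := C0 { c0_fun :> nat -> R^o ; c0_funP : c0_fun \in c0_pred }.

HB.instance Definition _ := [isSub for c0_fun].
HB.instance Definition _ := [Choice of c0 by <:].

Lemma c0_cvg (u : c0) : u n @[n --> \oo] --> (0 : R^o).
Proof. by case: u => u /= /[!inE]. Qed.

Lemma c0_submod_closed : submod_closed c0_pred.
Proof.
split; first by rewrite inE; exact: cvg_cst.
move=> a u v /[!inE]/= cu cv.
have -> : (0 : R^o) = a *: 0 + 0 by rewrite scaler0 addr0.
by apply: cvgD => //; exact: cvgZl_tmp.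
Qed.

HB.instance Definition _ :=
  GRing.isSubmodClosed.Build R (nat -> R^o) c0_pred c0_submod_closed.
HB.instance Definition _ := [SubChoice_isSubLmodule of c0 by <:].

Definition c0_norm (u : c0) : R := sup (range (fun n => `|u n|)).

Lemma c0_has_sup (u : c0) : has_sup (range (fun n => `|u n|)).
Proof.
split; first by exists `|u 0%N|; exists 0%N.
have /cvg_seq_bounded/pinfty_ex_gt0[M _ uM] : cvgn (u : nat -> R^o).
  by apply/cvg_ex; exists 0; exact: c0_cvg.
by exists M => _ [n _ <-]; exact: uM.
Qed.

Lemma ler_c0_norm (u : c0) n : `|u n| <= c0_norm u.
Proof. by apply: (sup_upper_bound (c0_has_sup u)); exists n. Qed.

Lemma c0_norm_le (u : c0) (M : R) :
  (forall n, `|u n| <= M) -> c0_norm u <= M.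
Proof.
move=> uM; apply: ge_sup; first by case: (c0_has_sup u).
by move=> _ [n _ <-].
Qed.

Lemma ler_c0_normD u v : c0_norm (u + v) <= c0_norm u + c0_norm v.
Proof.
apply: c0_norm_le => n.
by rewrite (le_trans (ler_normD _ _))// lerD// ler_c0_norm.
Qed.

Lemma c0_normZ (a : R) u : c0_norm (a *: u) = `|a| * c0_norm u.
Proof.
have le b v : c0_norm (b *: v) <= `|b| * c0_norm v.
  by apply: c0_norm_le => n; rewrite [leLHS]normrZ ler_wpM2l// ler_c0_norm.
apply/eqP; rewrite eq_le le/=.
have [->|a0] := eqVneq a 0.
  by rewrite normr0 mul0r (le_trans _ (ler_c0_norm _ 0%N)).
rewrite -ler_pdivlMl ?normr_gt0// -normfV.
by rewrite -{1}[u]scale1r -(mulVf a0) -scalerA le.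
Qed.

Lemma c0_norm0_eq0 u : c0_norm u = 0 -> u = 0.
Proof.
move=> u0; apply/val_inj/funext => n; apply/normr0_eq0/le_anti.
by rewrite normr_ge0 andbT -u0 ler_c0_norm.
Qed.

HB.instance Definition _ := Lmodule_isNormed.Build R c0
  ler_c0_normD c0_normZ c0_norm0_eq0.

End c0.

Section banach_space_notions.
Context {R : realType}.

Definition separable_space (T : topologicalType) :=
  exists2 D : set T, countable D & dense D.

(* The canonical map X -> X^** is onto. *)
Definition reflexive_space (X : normedModType R) :=
  forall phi : dual (dual X), exists x : X, forall f : dual X, phi f = f x.

(* T is a linear homeomorphism of E onto the subspace range T of F, with
   inverse S. *)
Definition contains_isomorphic_copy (E F : normedModType R) :=
  exists (T : {linear E -> F}) (S : F -> E),
    [/\ continuous T, cancel T S & {within range T, continuous S}].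

Lemma contains_isomorphic_copyP (E F : normedModType R) :
  contains_isomorphic_copy E F <->
  exists (T : {linear E -> F}) (c C : R),
    0 < c /\ forall x, c * `|x| <= `|T x| <= C * `|x|.
Proof.
split=> [[T [S [cT TK /subspace_continuousP cS]]]|[T [c [C [c0 bT]]]]].
  have [C TC] : exists C, forall x, `|T x| <= C * `|x|.
    move/linear_bounded_continuous/linear_boundedP: cT.
    by move=> /pinfty_ex_gt0[C _ TC]; exists C.
  have rT0 : range T 0 by exists 0; rewrite ?linear0.
  have S0 : S 0 = 0 by have := TK 0; rewrite linear0.
  have /cvgrPdist_lt/(_ _ ltr01) := cS _ rT0; rewrite near_withinE.
  move=> /nbhs_normP[d /= d0 Sd].
  exists T, (d / 2), C; split=> [|x]; first by rewrite divr_gt0.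
  rewrite TC andbT leNgt; apply/negP => Tx.
  have x0 : 0 < `|x|.
    rewrite normr_gt0; apply: contraTneq Tx => ->.
    by rewrite linear0 !normr0 mulr0 ltxx.
  have := Sd (T (`|x|^-1 *: x)).
  rewrite /from_subspace/= !sub0r !normrN TK S0 sub0r normrN.
  rewrite linearZ !normrZ normfV normr_id mulVf ?gt_eqF// ltxx.
  have xTd : `|x|^-1 * `|T x| < d.
    rewrite ltr_pdivrMl// mulrC (lt_trans Tx)// ltr_pM2r//.
    by rewrite ltr_pdivrMr// ltr_pMr// ltr1n.
  by move=> /(_ xTd) H; apply/notF/H; exists (`|x|^-1 *: x); rewrite ?linearZ.
have Tinj : injective T.
  move=> x y Txy; apply/subr0_eq/normr0_eq0/le_anti; rewrite normr_ge0 andbT.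
  have /andP[+ _] := bT (x - y).
  by rewrite linearB/= Txy subrr normr0 pmulr_rle0.
pose S (y : F) : E := xget 0 [set x | T x = y].
have TK : cancel T S.
  by move=> x; apply: Tinj; rewrite /S; case: xgetP => [y _ ->//|/(_ x)/=].
exists T, S; split=> //.
  apply/linear_bounded_continuous/linear_boundedP; near=> r => x.
  have /andP[_ /le_trans->//] := bT x.
  by apply: ler_wpM2r => //; near: r; exact: nbhs_pinfty_ge.
apply/subspace_continuousP => _ [x _ <-]; apply/cvgrPdist_lt => e e0.
rewrite near_withinE; apply/nbhs_normP; exists (c * e) => /=.
  exact: mulr_gt0.
move=> y /= xy [z _ zy]; rewrite -{}zy in xy *; rewrite /from_subspace !TK.
rewrite -(ltr_pM2l c0) (le_lt_trans _ xy)// -linearB.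
by have /andP[] := bT (x - z).
Unshelve. all: by end_near. Qed.

Definition weak_star_null (X : normedModType R) (f : nat -> dual X) :=
  forall x : X, f n x @[n --> \oo] --> (0 : R^o).

Definition property_Mstar (X : normedModType R) :=
  forall (f : nat -> dual X) (u v : dual X),
    weak_star_null f -> `|u| <= `|v| ->
    (limn_esup (fun n => `|f n + u|%:E) <= limn_esup (fun n => `|f n + v|%:E))%E.

Definition nonexpansive_on (Y : normedModType R) (C : set Y) (T : Y -> Y) :=
  forall x y, C x -> C y -> `|T x - T y| <= `|x - y|.

Definition fixed_point_property (Y : normedModType R) :=
  forall C : set Y, C !=set0 -> closed C -> bounded_set C -> convex_set C ->
  forall T : Y -> Y, set_fun C C T -> nonexpansive_on C T ->
  exists2 x, C x & T x = x.

End banach_space_notions.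

(* Main.v *)
Require Import Defs.
From HB Require Import structures.
From mathcomp Require Import all_boot all_order all_algebra.
From mathcomp Require Import all_classical all_reals all_analysis.
From mathcomp Require Import ring lra.

Set Implicit Arguments.
Unset Strict Implicit.
Unset Printing Implicit Defensive.

Import Order.TTheory GRing.Theory Num.Theory.
Import numFieldNormedType.Exports.

Local Open Scope classical_set_scope.
Local Open Scope ring_scope.

(* Everything is governed by one property of a Banach space Y, called [c0_like]:
   for every finite part of the unit ball there is an almost normalized z such
   that translation by z almost preserves it in the unit ball.  Iterating it
   gives an asymptotically isometric copy of c_0 in Y, and norming functionals of
   its basis span an asymptotically isometric copy of l_1 in Y^*; after rescaling
   the two bases, the right shifts are contractive, so neither Y nor Y^* has the
   FPP.

   If X is not reflexive, pick phi in X^** of norm 1 almost at distance 1 from X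
   and a weak* null sequence f_n in the unit ball of X^* with phi(f_n) close to 1.
   In lim |u + w_n|, property (M-star) lets one replace u by a vector almost
   normed by phi, so liminf (|u + w_n| - phi(w_n)) >= |u| for weak* null w_n:
   X^* behaves like an l_1-sum.  Dualizing by Hahn-Banach, X is c0_like.

   If X is reflexive, bounded sequences in X and X^* have weakly convergent
   subsequences, which excludes c_0 and l_1, and both spaces have property (M),
   the analogue of (M-star) for weakly null sequences.  Let y_n -> l weakly be
   approximate fixed points of a nonexpansive T with limsup |y_n - l| almost
   minimal.  The points of C whose asymptotic distance to (y_n) is at most that
   radius r form a T-invariant set.  By minimality it contains points at distance
   almost r from l, and by property (M) every u with |u| < r then satisfies
   limsup |y_n - l + u| <= r approximately, so the space would be c0_like.
   Hence the minimal radius is 0 in every invariant set, and a nested sequence of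
   invariant sets shrinks to a fixed point. *)

(** * Hahn-Banach theorems for sublinear functionals on a real vector space *)

Section sublinear.
Context {R : realType} (V : lmodType R).
Implicit Types p q : V -> R.

Definition sublinear p :=
  (forall x y, p (x + y) <= p x + p y) /\
  (forall t x, 0 <= t -> p (t *: x) = t * p x).

Lemma sublinear0 p : sublinear p -> p 0 = 0.
Proof. by case=> _ /(_ 0 0 (lexx _)); rewrite scale0r mul0r. Qed.

Lemma sublinearN p x : sublinear p -> - p (- x) <= p x.
Proof.
move=> sp; have := sp.1 x (- x); rewrite subrr sublinear0//; lra.
Qed.

(* Infimal convolution: a linear [phi <= inf_conv p G] satisfies both [phi <= p]
   and the constraints [phi g.1 <= g.2] for [g] in the convex cone [G]. *)
Definition inf_conv p (G : set (V * R)) (x : V) : R :=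
  inf [set p (x - g.1) + g.2 | g in G].

Section inf_conv.
Variables (p : V -> R) (G : set (V * R)).
Hypothesis sp : sublinear p.
Hypothesis G0 : G (0, 0).
Hypothesis GD : forall g h, G g -> G h -> G (g.1 + h.1, g.2 + h.2).
Hypothesis GZ : forall t g, 0 < t -> G g -> G (t *: g.1, t * g.2).
(** Compatibility of the constraints with [p]: a linear [phi <= p] with [phi g.1 <= g.2] satisfies
    [- g.2 <= phi (- g.1) <= p (- g.1)]. *)
Hypothesis Gp : forall g, G g -> - g.2 <= p (- g.1).

Lemma inf_conv_has_inf x : has_inf [set p (x - g.1) + g.2 | g in G].
Proof.
split; first by exists (p (x - 0) + 0), (0, 0).
exists (- p (- x)) => _ [g Gg <-].
have := sp.1 (x - g.1) (- x); rewrite addrAC subrr sub0r => H.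
by have := Gp Gg; lra.
Qed.

Lemma inf_conv_le x g : G g -> inf_conv p G x <= p (x - g.1) + g.2.
Proof. by move=> Gg; apply: ge_inf; [case: (inf_conv_has_inf x)|exists g]. Qed.

Lemma le_inf_conv x r :
  (forall g, G g -> r <= p (x - g.1) + g.2) -> r <= inf_conv p G x.
Proof.
move=> H; apply: lb_le_inf; first by case: (inf_conv_has_inf x).
by move=> _ [g Gg <-]; exact: H.
Qed.

Lemma inf_conv_lep x : inf_conv p G x <= p x.
Proof. by rewrite (le_trans (inf_conv_le x G0))//= subr0 addr0. Qed.

Lemma inf_conv_constraint g : G g -> inf_conv p G g.1 <= g.2.
Proof.
by move=> Gg; rewrite (le_trans (inf_conv_le _ Gg))// subrr sublinear0// add0r.
Qed.

Lemma inf_conv_sublinear : sublinear (inf_conv p G).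
Proof.
(* One inequality is enough for homogeneity: the reverse one is this one applied with [t^-1]. *)
have hZ t x : 0 < t -> inf_conv p G (t *: x) <= t * inf_conv p G x.
  move=> t0; rewrite -ler_pdivrMl//; apply: le_inf_conv => g Gg.
  rewrite ler_pdivrMl// mulrDr -(sp.2 _ _ (ltW t0)) scalerBr.
  exact: inf_conv_le (GZ t0 Gg).
split=> [x y|t x].
  rewrite -lerBlDl; apply: le_inf_conv => g Gg.
  rewrite lerBlDr -lerBlDl; apply: le_inf_conv => h Gh.
  have := inf_conv_le (x + y) (GD Gh Gg); rewrite /= opprD addrACA.
  by have := sp.1 (x - h.1) (y - g.1); lra.
rewrite le_eqVlt => /predU1P[<-|t0].
  rewrite scale0r mul0r; apply/le_anti/andP; split; first exact: inf_conv_constraint G0.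
  by apply: le_inf_conv => g Gg; rewrite sub0r; have := Gp Gg; lra.
apply/le_anti; rewrite hZ//= -ler_pdivlMl//.
by rewrite -{1}[x](scale1r) -(mulVf (lt0r_neq0 t0)) -scalerA hZ// invr_gt0.
Qed.

End inf_conv.

(* A minimal sublinear minorant [q] is linear: minimality forces
   [q x <= q (x + v) - q v]. *)
Lemma sublinear_linear_minorant p : sublinear p ->
  exists2 phi : V -> R, linear (phi : V -> R^o) & forall x, phi x <= p x.
Proof.
move=> sp; pose T := {q : V -> R | sublinear q /\ forall x, q x <= p x}.
(* The order is reversed, so a maximal element for Zorn is a minimal sublinear functional; a chain
   is bounded by its pointwise infimum. *)
pose le (q r : T) := `[< forall x, sval r x <= sval q x >].
have [| | | |q qmin] := @Zorn T le.
- by move=> q; apply/asboolP => x.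
- by move=> q r s /asboolP qr /asboolP rs; apply/asboolP => x; apply: le_trans (qr x).
- move=> [q ?] [r ?] /asboolP/= qr /asboolP/= rq; apply: eq_exist; apply/funext => x.
  by apply/le_anti; rewrite qr rq.
- move=> A Atot; have [[q0 Aq0]|A0] := pselect (exists q0 : T, A q0); last first.
    exists (exist _ p (conj sp (fun x => lexx (p x)))) => q Aq.
    by exfalso; apply: A0; exists q.
  pose m x := inf [set sval q x | q in A].
  have mi x : has_inf [set sval q x | q in A].
    split; first by exists (sval q0 x), q0.
    exists (- p (- x)) => _ [q Aq <-]; have [sq qp] := svalP q.
    by have := sublinearN x sq; have := qp (- x); lra.
  have mle x (q : T) : A q -> m x <= sval q x.
    by move=> Aq; apply: ge_inf; [case: (mi x)|exists q].
  have lem x r : (forall q : T, A q -> r <= sval q x) -> r <= m x.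
    move=> H; apply: lb_le_inf; first by case: (mi x).
    by move=> _ [q Aq <-]; exact: H.
  have sm : sublinear m.
    split=> [x y|t x t0].
      rewrite -lerBlDl; apply: (lem) => q Aq.
      suff : m (x + y) - sval q y <= m x by lra.
      apply: (lem) => r Ar.
      (* As [A] is a chain, the smaller of [q] and [r] can be used at both [x] and [y]. *)
      case: (Atot q r Aq Ar) => /asboolP H.
        have := mle (x + y) r Ar; have := (svalP r).1.1 x y; have := H y; lra.
      have := mle (x + y) q Aq; have := (svalP q).1.1 x y; have := H x; lra.
    move: t0; rewrite le_eqVlt => /predU1P[<-|t0].
      rewrite scale0r mul0r; apply/le_anti/andP; split.
        by rewrite (le_trans (mle _ _ Aq0))// sublinear0//; case: (svalP q0).
      by apply: (lem) => q Aq; rewrite sublinear0//; case: (svalP q).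
    apply/le_anti/andP; split.
      rewrite -ler_pdivrMl//; apply: (lem) => q Aq; rewrite ler_pdivrMl//.
      by rewrite (le_trans (mle _ _ Aq))// (svalP q).1.2// ltW.
    apply: (lem) => q Aq; rewrite (svalP q).1.2 ?(ltW t0)//.
    by apply: ler_wpM2l; rewrite ?(ltW t0)//; exact: mle.
  have mp x : m x <= p x by rewrite (le_trans (mle _ _ Aq0))//; apply: (svalP q0).2.
  by exists (exist _ m (conj sm mp)) => q Aq; apply/asboolP => x; exact: mle.
case: q qmin => q [sq qp] qmin.
have qD x y : q (x + y) = q x + q y.
  (* The infimal convolution of [q] with this ray is again sublinear and at most [q], so by
     minimality it is [q]; the point [t = 1] then gives [q x <= q (x + y) - q y]. *)
  pose G := [set (- (t *: y), - (t * q y)) | t in [set t : R | 0 <= t]].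
  have G0 : G (0, 0) by exists 0 => //=; rewrite scale0r mul0r !oppr0.
  have GD g h : G g -> G h -> G (g.1 + h.1, g.2 + h.2).
    move=> [t /= t0 <-] [s /= s0 <-]; exists (t + s); first exact: addr_ge0.
    by rewrite scalerDl mulrDl !opprD.
  have GZ t g : 0 < t -> G g -> G (t *: g.1, t * g.2).
    move=> t0 [s /= s0 <-]; exists (t * s); first by rewrite /= mulr_ge0// ltW.
    by rewrite scalerN scalerA mulrN mulrA.
  have Gq g : G g -> - g.2 <= q (- g.1).
    by move=> [t /= t0 <-]; rewrite !opprK sq.2.
  have sq' := inf_conv_sublinear sq G0 GD GZ Gq.
  have q'q := inf_conv_lep sq G0 Gq.
  have q'E : inf_conv q G = q.
    by apply/(congr1 sval (qmin (exist _ _ (conj sq'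
      (fun x => le_trans (q'q x) (qp x)))) _))/asboolP.
  have Gy : G (- y, - q y) by exists 1; rewrite /= ?scale1r ?mul1r.
  have := inf_conv_le sq G0 Gq x Gy; rewrite q'E/= opprK.
  have := sq.1 x y; lra.
have qN x : q (- x) = - q x.
  by apply/eqP; rewrite -addr_eq0 -qD addNr sublinear0.
have qZ t x : q (t *: x) = t * q x.
  have [t0|/ltW t0] := leP 0 t; first exact: sq.2.
  by rewrite -{1}[t]opprK scaleNr qN sq.2 ?oppr_ge0// mulNr opprK.
by exists q => // t x y; rewrite qD qZ.
Qed.

Lemma hahn_banach_cone p (G : set (V * R)) : sublinear p ->
  G (0, 0) -> (forall g h, G g -> G h -> G (g.1 + h.1, g.2 + h.2)) ->
  (forall t g, 0 < t -> G g -> G (t *: g.1, t * g.2)) ->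
  (forall g, G g -> - g.2 <= p (- g.1)) ->
  exists phi : V -> R, [/\ linear (phi : V -> R^o), forall x, phi x <= p x
    & forall g, G g -> phi g.1 <= g.2].
Proof.
move=> sp G0 GD GZ Gp; have [phi phil phip] :=
  sublinear_linear_minorant (inf_conv_sublinear sp G0 GD GZ Gp).
exists phi; split=> // [x|g Gg].
  by rewrite (le_trans (phip x))// inf_conv_lep.
by rewrite (le_trans (phip _))// inf_conv_constraint.
Qed.

(** Here [G] is a subspace and contains the opposite of each of its elements, which turns the
    inequalities of the cone version into equalities. *)
Lemma hahn_banach p (G : set (V * R)) : sublinear p ->
  G (0, 0) -> (forall t g h, G g -> G h -> G (t *: g.1 + h.1, t * g.2 + h.2)) ->
  (forall g, G g -> g.2 <= p g.1) ->
  exists phi : V -> R, [/\ linear (phi : V -> R^o), forall x, phi x <= p x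
    & forall g, G g -> phi g.1 = g.2].
Proof.
move=> sp G0 Glin Gp.
have GZ t g : G g -> G (t *: g.1, t * g.2).
  by move=> Gg; have := Glin t g _ Gg G0; rewrite /= !addr0.
have [|t g _ /GZ|g|phi [phil phip phiG]] := @hahn_banach_cone p G sp G0 _ _ _.
- by move=> g h Gg Gh; have := Glin 1 g h Gg Gh; rewrite scale1r mul1r.
- exact.
- by move=> /(GZ (- 1))/Gp/=; rewrite scaleN1r mulN1r.
exists phi; split=> // g Gg; apply/le_anti; rewrite phiG//=.
have := phiG _ (GZ (- 1) _ Gg); rewrite /= scaleN1r mulN1r.
have := phil (- 1) g.1 0; have := phil (- 1) 0 0.
rewrite !scaleN1r !addr0 oppr0 => ->; lra.
Qed.

Lemma hahn_banach_point p x : sublinear p ->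
  exists phi : V -> R, [/\ linear (phi : V -> R^o), forall y, phi y <= p y
    & phi x = p x].
Proof.
move=> sp; pose G := [set (t *: x, t * p x) | t in [set: R]].
have [||g|phi [? ? phix]] := @hahn_banach p G sp.
- by exists 0; rewrite // scale0r mul0r.
- move=> t g h [a _ <-] [b _ <-]; exists (t * a + b) => //=.
  by rewrite scalerDl mulrDl scalerA mulrA.
- move=> [t _ <-]/=; have [t0|t0] := leP 0 t; first by rewrite sp.2.
  have := sublinearN (t *: x) sp; rewrite -scaleNr sp.2; last by lra.
  by rewrite mulNr opprK.
- exists phi; split=> //; have := phix (1 *: x, 1 * p x).
  by rewrite scale1r mul1r; apply; exists 1; rewrite // scale1r mul1r.
Qed.

End sublinear.

(** * Norming, extending and separating functionals on normed spaces; weak convergence *)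

Section dual_basics.
Context {R : realType}.
Implicit Types X Y : normedModType R.

Lemma sublinear_norm X (M : R) : 0 <= M -> sublinear (fun x : X => M * `|x|).
Proof.
move=> M0; split=> [x y|t x t0]; last by rewrite normrZ ger0_norm// mulrCA.
by rewrite -mulrDr ler_wpM2l// ler_normD.
Qed.

Lemma dual_of_linear X (phi : X -> R) (M : R) : 0 <= M ->
  linear (phi : X -> R^o) -> (forall x, phi x <= M * `|x|) ->
  exists f : dual X, `|f| <= M /\ forall x, f x = phi x.
Proof.
move=> M0 phil phiM.
pose L : {linear X -> R^o} :=
  HB.pack (phi : X -> R^o) (GRing.isLinear.Build R X R^o *:%R phi phil).
have phiM' x : `|phi x| <= M * `|x|.
  by rewrite ler_norml phiM andbT lerNl -(linearN L) -normrN; exact: phiM.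
have cphi : continuous (phi : X -> R^o).
  apply: (@linear_bounded_continuous _ _ _ L).1.
  apply/linear_boundedP; near=> r => x; apply: le_trans (phiM' x) _.
  by apply: ler_wpM2r => //; near: r; exact: nbhs_pinfty_ge.
have phiP : (phi : X -> R^o) \in @dual_pred R X by rewrite inE; split.
exists (Dual phiP); split=> //; rewrite dual_normE; apply: dual_norm_le => x x1.
by rewrite (le_trans (phiM' x))// ler_piMr.
Unshelve. all: by end_near. Qed.

Lemma norming_functional X (x : X) : exists f : dual X, `|f| <= 1 /\ f x = `|x|.
Proof.
have [phi [phil phip phix]] := hahn_banach_point x (@sublinear_norm X 1 ler01).
have [f [f1 fE]] := dual_of_linear ler01 phil phip.
by exists f; rewrite fE phix mul1r.
Qed.

Lemma bidual_eval X (x : X) :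
  exists phi : dual (dual X), forall f, phi f = f x.
Proof.
have [|//|f|phi [_ phiE]] := @dual_of_linear (dual X) (fun f => f x) `|x| _ _ _.
- exact: normr_ge0.
- by rewrite (le_trans (ler_norm _))// mulrC ler_dual_norm.
- by exists phi.
Qed.

(** The bound makes [T e |-> tau e] a well-defined functional on the range of [T]; its graph is the
    subspace [G] of constraints. *)
Lemma dual_extend (E : lmodType R) Y (T : {linear E -> Y}) (tau : {linear E -> R^o})
    (M : R) : 0 <= M -> (forall e, `|tau e| <= M * `|T e|) ->
  exists f : dual Y, `|f| <= M /\ forall e, f (T e) = tau e.
Proof.
move=> M0 tauM; pose G : set (Y * R) := [set (T e, tau e) | e in [set: E]].
have [||_ [e _ <-]|phi [phil phip phiG]] := hahn_banach (G := G) (@sublinear_norm Y M M0).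
- by exists 0; rewrite ?linear0.
- by move=> t _ _ [e _ <-] [e' _ <-]; exists (t *: e + e'); rewrite // !linearP.
- exact: le_trans (ler_norm _) (tauM e).
have [f [fM fE]] := dual_of_linear M0 phil phip.
exists f; split=> // e; rewrite fE.
by apply: (phiG (T e, tau e)); exists e.
Qed.

Lemma convex_setP (V : lmodType R) (C : set V) : convex_set C <->
  forall (x y : V) (t : R), 0 <= t <= 1 -> C x -> C y ->
    C (t *: x + (1 - t) *: y).
Proof.
split=> [cC x y t /andP[t0 t1] Cx Cy|cC x y t].
  by have := cC x y (Itv01 t0 t1) (mem_set Cx) (mem_set Cy); rewrite inE.
by rewrite !inE => Cx Cy; apply: cC => //; rewrite ge0 le1.
Qed.

Lemma convex_set_scaleD (V : lmodType R) (C : set V) (x y : V) (a b : R) :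
  convex_set C -> 0 <= a -> 0 <= b -> 0 < a + b -> C x -> C y ->
  exists2 z, C z & a *: x + b *: y = (a + b) *: z.
Proof.
move=> /convex_setP cC a0 b0 ab Cx Cy.
exists ((a / (a + b)) *: x + (1 - a / (a + b)) *: y).
  apply: cC => //; rewrite divr_ge0//= ?(ltW ab)//.
  by rewrite ler_pdivrMr// mul1r lerDl.
rewrite scalerDr !scalerA mulrBr mulr1 mulrCA divff ?gt_eqF// mulr1.
by rewrite addrAC subrr add0r.
Qed.

(** The conditions [f (c - y) <= - d] are imposed through the cone that they generate: convexity of
    [C] makes it closed under sums, and the distance bound makes it compatible with the norm. *)
Lemma dist_separation Y (C : set Y) (y : Y) (d : R) : convex_set C ->
  0 <= d -> (forall c, C c -> d <= `|c - y|) ->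
  exists f : dual Y, `|f| <= 1 /\ forall c, C c -> f c + d <= f y.
Proof.
move=> cC d0 Cd.
pose G : set (Y * R) := [set g | g = (0, 0) \/
  exists t c, [/\ 0 < t, C c & g = (t *: (c - y), - (t * d))]].
have [|g h|t g|g|phi [phil phip phiG]] :=
    hahn_banach_cone (G := G) (@sublinear_norm Y 1 ler01).
- by left.
- move=> [->|[t [c [t0 Cc ->]]]]; first by rewrite /= !add0r -surjective_pairing.
  move=> [->|[s [b [s0 Cb ->]]]].
    by right; exists t, c; split=> //=; rewrite !addr0.
  have [e Ce cb] := convex_set_scaleD cC (ltW t0) (ltW s0) (addr_gt0 t0 s0) Cc Cb.
  right; exists (t + s), e; split; rewrite ?addr_gt0//=; congr pair; last by ring.
  by rewrite !scalerBr -cb scalerDl opprD addrACA.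
- move=> t0 [->|[s [c [s0 Cc ->]]]]; first by left; rewrite /= scaler0 mulr0.
  right; exists (t * s), c; split; rewrite ?mulr_gt0//=.
  by rewrite scalerA mulrN mulrA.
- move=> [->|[t [c [t0 Cc ->]]]] /=; first by rewrite !oppr0 normr0 mulr0.
  by rewrite opprK mul1r normrN normrZ gtr0_norm// ler_pM2l// Cd.
have [f [f1 fE]] := dual_of_linear ler01 phil phip.
exists f; split=> // c Cc; have := phiG (1 *: (c - y), - (1 * d)).
rewrite -fE /= scale1r mul1r linearB/= => H.
suff : f c - f y <= - d by lra.
by apply: H; right; exists 1, c; split; rewrite ?scale1r ?mul1r.
Qed.

Definition weak_cvg Y (u : nat -> Y) (l : Y) :=
  forall f : dual Y, f (u n) @[n --> \oo] --> (f l : R^o).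

(** Mazur's theorem: a functional separating [l] from [C] with gap [d] would keep [f (u n)] at
    distance at least [d] from [f l]. *)
Lemma weak_cvg_dist Y (C : set Y) (u : nat -> Y) (l : Y) : convex_set C ->
  (forall n, C (u n)) -> weak_cvg u l ->
  forall d, 0 < d -> exists2 c, C c & `|c - l| < d.
Proof.
move=> cC Cu ul d d0; apply: contrapT => H.
have [|f [_ fd]] := @dist_separation _ C l d cC (ltW d0).
  by move=> c Cc; rewrite leNgt; apply/negP => ?; apply: H; exists c.
have /cvgrPdist_lt/(_ _ d0)[N _ /(_ N (leqnn _))/=] := ul f.
have := fd _ (Cu N); rewrite ltr_norml; lra.
Qed.

Lemma weak_cvg_closed Y (C : set Y) (u : nat -> Y) (l : Y) : convex_set C ->
  closed C -> (forall n, C (u n)) -> weak_cvg u l -> C l.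
Proof.
move=> cC clC Cu ul; rewrite (closure_id C).1// => B /nbhs_normP[e /= e0 eB].
have [c Cc ce] := weak_cvg_dist cC Cu ul e0.
by exists c; split=> //; apply: eB; rewrite /= distrC.
Qed.

End dual_basics.

(** * Subsequences, ultrafilter limits and diagonal extraction *)

Section subsequences.

(** Throughout, a subsequence is given by [s] with [n <= s n]; monotonicity is not demanded, since
    this bound already carries limits at infinity over. *)
Lemma cvg_subseq (T : topologicalType) (u : nat -> T) (l : T) (s : nat -> nat) :
  (forall n, (n <= s n)%N) -> u n @[n --> \oo] --> l ->
  u (s n) @[n --> \oo] --> l.
Proof.
move=> ns ul; apply: (cvg_comp s u _ ul) => A [N _ NA]; exists N => // n /= Nn.
by apply: NA; exact: leq_trans (ns n).
Qed.

Lemma near_subseq (s : nat -> nat) (P : nat -> Prop) :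
  (forall n, (n <= s n)%N) -> (\forall n \near \oo, P n) ->
  \forall n \near \oo, P (s n).
Proof.
by move=> ns [N _ NP]; exists N => // n /= Nn; apply: NP; exact: leq_trans (ns n).
Qed.

Lemma not_near_subseq (P : nat -> Prop) : ~ (\forall n \near \oo, P n) ->
  exists s : nat -> nat, (forall n, (n <= s n)%N) /\ forall n, ~ P (s n).
Proof.
move=> nP; have /choice[s sP] : forall n, exists m, (n <= m)%N /\ ~ P m.
  move=> n; apply: contrapT => H; apply: nP; exists n => // m /= nm.
  by apply: contrapT => Pm; apply: H; exists m.
by exists s; split=> n; case: (sP n).
Qed.

Lemma near_seq (I : eqType) (s : seq I) (P : I -> nat -> Prop) :
  (forall x, x \in s -> \forall n \near \oo, P x n) ->
  \forall n \near \oo, forall x, x \in s -> P x n.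
Proof.
elim: s => [|x s IH] Ps; first by apply: nearW => n x; rewrite in_nil.
have H1 := Ps x (mem_head _ _).
have H2 : \forall n \near \oo, forall x, x \in s -> P x n.
  by apply: IH => x' x's; apply: Ps; rewrite in_cons x's orbT.
near=> n => x'; rewrite in_cons => /predU1P[->|]; first by near: n.
by move: x'; near: n.
Unshelve. all: by end_near. Qed.

Context {R : realType}.

Lemma not_cvg_subseq (u : nat -> R) (l : R) : ~ (u n @[n --> \oo] --> l) ->
  exists (e : R) (s : nat -> nat), [/\ 0 < e, forall n, (n <= s n)%N
    & forall n, e <= `|l - u (s n)|].
Proof.
move=> nul; apply: contrapT => H; apply: nul; apply/cvgrPdist_lt => e e0.
apply: contrapT => /not_near_subseq[s [ns us]]; apply: H.
by exists e, s; split=> // n; rewrite leNgt; apply/negP/us.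
Qed.

Lemma ultra_bounded_cvg (T : Type) (U : set_system T) (u : T -> R) (M : R) :
  UltraFilter U -> (forall n, `|u n| <= M) -> exists l : R, u n @[n --> U] --> l.
Proof.
move=> UU uM.
have [|l [_ ul]] := @segment_compact _ (- M) M (u n @[n --> U]) _ _.
  by apply: (@filterE _ U) => n /=; rewrite in_itv/= -ler_norml.
exists l; apply/cvgrPdist_lt => e e0.
have [//|H] := in_ultra_setVsetC [set n | `|l - u n| < e] UU.
have [] := ul [set r | ~ `|l - r| < e] (ball l e) H (nbhsx_ballx _ _ e0).
by move=> r [].
Qed.

(** One ultrafilter finer than [\oo] provides the limits of all the [u i] at once; countability of
    [I] then allows [s n] to be picked where the first [n] sequences are all within [1/(n+1)] of
    their limits. *)
Lemma diagonal_subsequence (I : countType) (u : I -> nat -> R) :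
  (forall i, exists M : R, forall n, `|u i n| <= M) ->
  exists s : nat -> nat, (forall n, (n <= s n)%N) /\
    exists L : I -> R, forall i, u i (s n) @[n --> \oo] --> L i.
Proof.
move=> ub; have [U [UU oU]] := @ultraFilterLemma nat \oo _.
have /choice[L uL] : forall i, exists l : R, u i n @[n --> U] --> l.
  by move=> i; have [M uM] := ub i; exact: ultra_bounded_cvg uM.
(* The indices of [I] are read through [unpickle]; a number that codes no index imposes no
   condition. *)
pose P k j n := if @unpickle I j is Some i
  then `|L i - u i n| < k.+1%:R^-1 else true.
have UP k m : U [set n | forall j, (j < m)%N -> P k j n].
  elim: m => [|m IH]; first by apply: filterE.
  have UPm : U [set n | P k m n].
    rewrite /P; case: unpickle => [i|]; last by apply: filterE.
    by have /cvgrPdist_lt := uL i; apply; rewrite invr_gt0.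
  near=> n => j; rewrite ltnS leq_eqVlt => /predU1P[->|].
    by near: n.
  by move: j; near: n.
have /choice[s sP] : forall k, exists n, (k <= n)%N /\ forall j, (j < k)%N -> P k j n.
  move=> k; have : U ([set n | k <= n]%N `&` [set n | forall j, (j < k)%N -> P k j n]).
    by apply: filterI => //; apply: oU; exists k.
  by move=> /filter_ex[n []]; exists n.
exists s; split=> [n|]; first by case: (sP n).
exists L => i; apply/cvgrPdist_lt => e e0; near=> n.
have := (sP n).2 (pickle i); rewrite /P pickleK => H.
apply: (lt_trans (H _)); first by near: n; exact: nbhs_infty_gt.
by near: n; exact: near_infty_natSinv_lt (PosNum e0).
Unshelve. all: by end_near. Qed.

Lemma cauchy_cvgn (V : completeNormedModType R) (u : nat -> V) :
  (forall e, 0 < e -> exists N, forall n, (N <= n)%N -> `|u N - u n| < e) ->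
  cvgn u.
Proof.
move=> cu; apply/cauchy_cvgP/cauchy_exP => e /cu[N uN].
by exists (u N); exists N => // n /= Nn; rewrite -ball_normE/=; exact: uN.
Qed.

Lemma separable_dense_seq (X : normedModType R) : separable_space X ->
  exists d : nat -> X, forall x e, 0 < e -> exists k, `|x - d k| < e.
Proof.
move=> [D cD dD].
have De x (e : R) : 0 < e -> exists2 d, D d & `|x - d| < e.
  move=> e0; have [|d [/= xd Dd]] := dD (ball x e) _ (ball_open _ _).
    by exists x; exact: ballxx.
  by exists d; rewrite // -ball_normE in xd *.
have /pfcard_geP[D0|/unsquash f] := cD.
  by have [d] := De 0 1 ltr01; rewrite D0.
exists f => x e e0; have [d Dd xd] := De x e e0.
have [k _ fk] := @surj _ _ _ _ f d Dd.
by exists k; rewrite fk.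
Qed.

End subsequences.

(** * Sequential Banach-Alaoglu, and weak sequential compactness under reflexivity *)

Section weak_compactness.
Context {R : realType}.

Definition weakly_seq_compact (Y : normedModType R) :=
  forall (u : nat -> Y) (M : R), (forall n, `|u n| <= M) ->
  exists (s : nat -> nat) (l : Y), (forall n, (n <= s n)%N) /\ weak_cvg (u \o s) l.

(** Diagonal extraction on a dense sequence [d] gives convergence at each [d k], and the uniform
    Lipschitz bound [M] extends it to all of [X]. *)
Lemma separable_alaoglu (X : normedModType R) (I : countType)
    (f : I -> nat -> dual X) : separable_space X ->
  (forall i, exists M : R, forall n, `|f i n| <= M) ->
  exists (s : nat -> nat) (g : I -> dual X), (forall n, (n <= s n)%N) /\
    forall i x, f i (s n) x @[n --> \oo] --> (g i x : R^o).
Proof.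
move=> /separable_dense_seq[d dX] fM.
have [|s [ns [L uL]]] :=
    diagonal_subsequence (u := fun p : I * nat => fun n => f p.1 n (d p.2)).
  move=> [i k]; have [M fiM] := fM i; exists (M * `|d k|) => n.
  by rewrite (le_trans (ler_dual_norm _ _))// ler_wpM2r//; exact: fiM.
suff /choice[g fg] : forall i, exists g : dual X, forall x,
    f i (s n) x @[n --> \oo] --> (g x : R^o).
  by exists s, g.
move=> i; have [M fiM] := fM i.
have M0 : 0 <= M by rewrite (le_trans _ (fiM 0%N)).
have fdist n x y : `|f i n x - f i n y| <= M * `|x - y|.
  rewrite -linearB (le_trans (ler_dual_norm _ _))// ler_wpM2r//; exact: fiM.
pose G x := limn (fun n => f i (s n) x : R^o).
have fG x : f i (s n) x @[n --> \oo] --> G x.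
  apply: (@cauchy_cvgn R^o) => e e0.
  (* Four errors of [e / 4]: two for replacing [x] by [d k], two for the convergence at [d k]. The
     divisor is [M + 1] because [M] may be 0. *)
  have e'0 : 0 < e / 4 / (M + 1) by rewrite !divr_gt0// ltr_wpDl.
  have [k xk] := dX x _ e'0.
  have xkM : M * `|x - d k| < e / 4.
    have [->|Mn0] := eqVneq M 0; first by rewrite mul0r divr_gt0.
    apply: le_lt_trans (_ : (M + 1) * `|x - d k| < _); first by rewrite ler_wpM2r// lerDl.
    by rewrite -ltr_pdivlMl ?ltr_wpDl// mulrC.
  have /cvgrPdist_lt/(_ (e / 4))[|N _ uN] := uL (i, k); first by rewrite divr_gt0.
  exists N => n Nn /=.
  have := uN N (leqnn _); have := uN n Nn => /=.
  have := fdist (s n) x (d k); have := fdist (s N) x (d k).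
  rewrite !ltr_norml !ler_norml; lra.
have Gl : linear (G : X -> R^o).
  move=> a x y; apply/cvg_lim => //.
  have -> : (fun n => f i (s n) (a *: x + y) : R^o) =
      (fun n => a *: (f i (s n) x : R^o) + f i (s n) y).
    by apply/funext => n; rewrite linearP.
  by apply: cvgD => //; apply: cvgZl_tmp.
have [|g [_ gE]] := dual_of_linear M0 Gl.
  move=> x; apply: (cvgr_to_le (fG x)); near=> n.
  rewrite (le_trans (ler_norm _))// (le_trans (ler_dual_norm _ _))// ler_wpM2r//.
  exact: fiM.
by exists g => x; rewrite gE; exact: fG.
Unshelve. all: by end_near. Qed.

Lemma separable_alaoglu1 (X : normedModType R) (f : nat -> dual X) (M : R) :
  separable_space X -> (forall n, `|f n| <= M) ->
  exists (s : nat -> nat) (g : dual X), (forall n, (n <= s n)%N) /\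
    forall x, f (s n) x @[n --> \oo] --> (g x : R^o).
Proof.
move=> sX fM; have [|s [g [ns fg]]] := @separable_alaoglu X unit (fun=> f) sX.
  by move=> _; exists M.
by exists s, (g tt).
Qed.

Lemma dual_weakly_seq_compact (X : normedModType R) :
  separable_space X -> reflexive_space X -> weakly_seq_compact (dual X).
Proof.
move=> sX rX f M fM; have [s [g [ns fg]]] := separable_alaoglu1 sX fM.
exists s, g; split=> // phi; have [x phix] := rX phi.
rewrite phix (_ : (fun n => _) = (fun n => f (s n) x : R^o)); first exact: fg.
by apply/funext => n; rewrite phix.
Qed.

(** The ultrafilter limits of [f (u n)] are linear and bounded in [f], hence an element of the
    bidual, which reflexivity represents by a point. *)
Lemma reflexive_cluster (X : normedModType R) (u : nat -> X) (M : R) :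
  reflexive_space X -> (forall n, `|u n| <= M) ->
  exists U : set_system nat, [/\ ProperFilter U, \oo `<=` U &
    exists x, forall f : dual X, f (u n) @[n --> U] --> (f x : R^o)].
Proof.
move=> rX uM; have [U [UU oU]] := @ultraFilterLemma nat \oo _.
exists U; split=> //; first exact: ultra_proper.
have M0 : 0 <= M by rewrite (le_trans _ (uM 0%N)).
have fu (f : dual X) n : `|f (u n)| <= M * `|f|.
  by rewrite (le_trans (ler_dual_norm _ _))// mulrC ler_wpM2r// dual_norm_ge0.
have /choice[L uL] : forall f : dual X, exists l : R, f (u n) @[n --> U] --> l.
  by move=> f; exact: ultra_bounded_cvg (fu f).
have Ll : linear (L : dual X -> R^o).
  move=> a f g; apply: (cvg_unique _ (uL (a *: f + g))) => //.
  by apply: (@cvgD _ R^o); [apply: (@cvgZl_tmp _ R^o); exact: uL|exact: uL].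
have [|phi [_ phiE]] := dual_of_linear M0 Ll.
  move=> f; apply: (cvgr_to_le (uL f)); apply: filterE => n /=.
  exact: le_trans (ler_norm _) (fu f n).
by have [x phix] := rX phi; exists x => f; rewrite -phix phiE; exact: uL.
Qed.

(** Separability of the dual is avoided: norming functionals of a dense sequence separate points, so
    after diagonal extraction along them only one weak cluster point remains, and the subsequence
    converges weakly to it. *)
Lemma reflexive_weakly_seq_compact (X : normedModType R) :
  separable_space X -> reflexive_space X -> weakly_seq_compact X.
Proof.
move=> /separable_dense_seq[d dX] rX u M uM.
have /choice[f fd] := fun k => norming_functional (d k).
have f_sep x y : (forall k, f k x = f k y) -> x = y.
  move=> fxy; apply/subr0_eq/normr0_eq0/le_anti; rewrite normr_ge0 andbT.
  apply/ler_addgt0Pl => e e0; rewrite addr0.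
  have [k xyk] := dX (x - y) (e / 2) (divr_gt0 e0 (ltr0Sn _ _)).
  (* [f k] vanishes at [x - y] and norms [d k], so a [d k] close to [x - y] must be small. *)
  have : `|d k| <= `|x - y - d k|.
    rewrite -{1}(fd k).2 (_ : f k (d k) = - f k (x - y - d k)); last first.
      by rewrite !linearB/= fxy subrr sub0r opprK.
    rewrite (le_trans (ler_norm _))// normrN (le_trans (ler_dual_norm _ _))//.
    by rewrite ler_piMl// (fd k).1.
  have := ler_normD (x - y - d k) (d k); rewrite subrK; lra.
have [|s [ns [L uL]]] := diagonal_subsequence (u := fun k n => f k (u n)).
  move=> k; exists M => n; rewrite (le_trans (ler_dual_norm _ _))//.
  by rewrite (le_trans _ (uM n))// ler_piMl// (fd k).1.
have [U [PU oU [x ux]]] := reflexive_cluster rX (fun n => uM (s n)).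
exists s, x; split=> // g; apply: contrapT => /not_cvg_subseq[e [t [e0 nt gt]]].
have [V [PV oV [y uy]]] := reflexive_cluster rX (fun n => uM (s (t n))).
have xy : x = y.
  apply: f_sep => k; apply/eqP; rewrite -[f k x]/(f k x : R^o); apply/eqP.
  transitivity (L k).
    apply: (cvg_unique _ (ux (f k))) => //.
    by apply: cvg_trans (uL k); exact: cvg_app oU.
  apply: esym; apply: (cvg_unique _ (uy (f k))) => //.
  apply: cvg_trans (cvg_subseq nt (uL k)); exact: cvg_app oV.
have /cvgrPdist_lt/(_ _ e0)/filter_ex[n] := uy g.
by rewrite -xy ltNge gt.
Qed.

End weak_compactness.

(** * Norm estimates and completeness of l_1 and c_0 *)

Section ell1_c0.
Context {R : realType}.

Lemma ell1_exists (u : nat -> R) : cvgn (series (fun n => `|u n|)) ->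
  exists a : ell1 R, forall n, a n = u n.
Proof.
move=> cu; have uP : (u : nat -> R^o) \in @ell1_pred R by rewrite inE.
by exists (Ell1 uP).
Qed.

Lemma c0_exists (u : nat -> R) : u n @[n --> \oo] --> 0 ->
  exists a : c0 R, forall n, a n = u n.
Proof.
move=> cu; have uP : (u : nat -> R^o) \in @c0_pred R by rewrite inE.
by exists (C0 uP).
Qed.

Lemma ell1E (a b : ell1 R) : (forall n, a n = b n) -> a = b.
Proof. by move=> ab; apply/val_inj/funext. Qed.

Lemma ell1DE (a b : ell1 R) n : (a + b) n = a n + b n. Proof. by []. Qed.
Lemma ell1ZE t (a : ell1 R) n : (t *: a) n = t * a n. Proof. by []. Qed.
Lemma c0DE (a b : c0 R) n : (a + b) n = a n + b n. Proof. by []. Qed.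
Lemma c0ZE t (a : c0 R) n : (t *: a) n = t * a n. Proof. by []. Qed.
Lemma ell1NE (a : ell1 R) n : (- a) n = - a n. Proof. by []. Qed.
Lemma c0NE (a : c0 R) n : (- a) n = - a n. Proof. by []. Qed.

Lemma ell1_norm_cvg (a : ell1 R) :
  \sum_(0 <= i < n) `|a i| @[n --> \oo] --> `|a|.
Proof. exact: ell1_cvg. Qed.

Lemma ell1_norm_ge (a : ell1 R) n : \sum_(0 <= i < n) `|a i| <= `|a|.
Proof.
apply: (@nondecreasing_cvgn_le _ (series (fun n => `|a n|))); last exact: ell1_cvg.
by apply: nondecreasing_series => i _ _; exact: normr_ge0.
Qed.

Lemma ell1_norm_le (a : ell1 R) (M : R) :
  (forall n, \sum_(0 <= i < n) `|a i| <= M) -> `|a| <= M.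
Proof.
by move=> aM; apply: limr_le; [exact: ell1_cvg|exact: nearW].
Qed.

Lemma bounded_series_ell1 (u : nat -> R) (M : R) :
  (forall n, \sum_(0 <= i < n) `|u i| <= M) -> cvgn (series (fun n => `|u n|)).
Proof.
move=> uM; apply: nondecreasing_is_cvgn.
  by apply: nondecreasing_series => i _ _; exact: normr_ge0.
by exists M => _ [n _ <-]; exact: uM.
Qed.

Lemma ell1_coord (a : ell1 R) n : `|a n| <= `|a|.
Proof.
rewrite (le_trans _ (ell1_norm_ge a n.+1))// big_nat_recr//= lerDr.
exact: sumr_ge0.
Qed.

(** For a fixed number [m] of terms the Cauchy bound passes to the coordinatewise limit, and it is
    uniform in [m]. *)
Lemma ell1_complete (a : nat -> ell1 R) :
  (forall e, 0 < e -> exists N, forall n, (N <= n)%N -> `|a N - a n| < e) ->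
  exists b : ell1 R, a n @[n --> \oo] --> b.
Proof.
move=> ca.
have ci i : cvgn (fun n => a n i : R^o).
  apply: (@cauchy_cvgn R R^o) => e e0; have [N aN] := ca _ e0.
  by exists N => n Nn; exact: le_lt_trans (ell1_coord (a N - a n) i) (aN n Nn).
pose u i := limn (fun n => a n i : R^o).
have tail e : 0 < e -> exists N, forall n, (N <= n)%N -> forall m,
    \sum_(0 <= i < m) `|u i - a n i| <= e.
  move=> e0; have [N aN] := ca (e / 2) (divr_gt0 e0 (ltr0Sn _ _)).
  exists N => n Nn m.
  have : \sum_(0 <= i < m) `|a k i - a n i| @[k --> \oo] -->
         \sum_(0 <= i < m) `|u i - a n i|.
    apply: cvg_big => [|i _]; first exact: add_continuous.
    by apply: cvg_norm; apply: (@cvgB _ R^o); [exact: ci|exact: cvg_cst].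
  move=> /cvgr_to_le; apply; exists N => // k /= Nk.
  rewrite (le_trans (ell1_norm_ge (a k - a n) m))//.
  have := ler_normD (a k - a N) (a N - a n); rewrite addrA subrK (distrC (a k) (a N)).
  have := aN n Nn; have := aN k Nk; lra.
have [N uN] := tail 1 ltr01.
have [b bE] : exists b : ell1 R, forall n, b n = u n.
  apply: ell1_exists; apply: (@bounded_series_ell1 _ (1 + `|a N|)) => m.
  rewrite (le_trans _ (lerD (uN N (leqnn _) m) (ell1_norm_ge (a N) m)))//.
  rewrite -big_split/=; apply: ler_sum => i _.
  by rewrite -{1}[u i](subrK (a N i)) ler_normD.
exists b; apply/cvgrPdist_le => e /tail[M uM]; exists M => // n /= Mn.
apply: ell1_norm_le => m; rewrite (le_trans _ (uM n Mn m))//.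
by apply: ler_sum => i _; rewrite ell1DE ell1NE bE.
Qed.

Lemma c0_complete (a : nat -> c0 R) :
  (forall e, 0 < e -> exists N, forall n, (N <= n)%N -> `|a N - a n| < e) ->
  exists b : c0 R, a n @[n --> \oo] --> b.
Proof.
move=> ca.
have ci i : cvgn (fun n => a n i : R^o).
  apply: (@cauchy_cvgn R R^o) => e e0; have [N aN] := ca _ e0.
  by exists N => n Nn; exact: le_lt_trans (ler_c0_norm (a N - a n) i) (aN n Nn).
pose u i := limn (fun n => a n i : R^o).
have tail e : 0 < e -> exists N, forall n, (N <= n)%N -> forall i, `|u i - a n i| <= e.
  move=> e0; have [N aN] := ca (e / 2) (divr_gt0 e0 (ltr0Sn _ _)).
  exists N => n Nn i.
  have : `|a k i - a n i| @[k --> \oo] --> `|u i - a n i|.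
    by apply: cvg_norm; apply: (@cvgB _ R^o); [exact: ci|exact: cvg_cst].
  move=> /cvgr_to_le; apply; exists N => // k /= Nk.
  rewrite (le_trans (ler_c0_norm (a k - a n) i))//.
  have := ler_normD (a k - a N) (a N - a n); rewrite addrA subrK (distrC (a k) (a N)).
  have := aN n Nn; have := aN k Nk; rewrite -[c0_norm _]/(`|a k - a n|); lra.
have [b bE] : exists b : c0 R, forall n, b n = u n.
  apply: c0_exists; apply/cvgrPdist_lt => e e0.
  have [N uN] := tail (e / 2) (divr_gt0 e0 (ltr0Sn _ _)).
  have := @c0_cvg R (a N) => /cvgrPdist_lt/(_ (e / 2) (divr_gt0 e0 (ltr0Sn _ _))).
  apply: filterS => i; rewrite !sub0r !normrN => aNi.
  have := ler_normD (u i - a N i) (a N i); rewrite subrK.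
  by have := uN N (leqnn _) i; lra.
exists b; apply/cvgrPdist_le => e /tail[M uM]; exists M => // n /= Mn.
by apply: c0_norm_le => i; rewrite c0DE c0NE bE; exact: uM.
Qed.

End ell1_c0.

(** * An obstruction to embedding into weakly sequentially compact spaces *)

Section embeddings.
Context {R : realType}.
Implicit Types (E Y : normedModType R).

(** Extend each [tau N] through [T] to [h N]. A weak limit [l] of the [T (e n)] has [h N l = 1] for
    every [N]; by Mazur some [T a] is within [c / 2] of [l], which forces [tau N a >= 1/2] and
    contradicts [tau N a -> 0]. *)
Lemma weakly_seq_compact_no_copy E Y (e : nat -> E) (K : R)
    (tau : nat -> {linear E -> R^o}) :
  (forall n, `|e n| <= K) -> (forall N a, `|tau N a| <= `|a|) ->
  (forall N n, (N <= n)%N -> tau N (e n) = 1) ->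
  (forall a, tau N a @[N --> \oo] --> (0 : R^o)) ->
  weakly_seq_compact Y -> ~ contains_isomorphic_copy E Y.
Proof.
move=> eK tau1 taue tau0 wY /contains_isomorphic_copyP[T [c [C [c0 bT]]]].
have [|s [l [ns ul]]] := wY (T \o e) (`|C| * K).
  move=> n; have /andP[_ /le_trans->//] := bT (e n).
  by rewrite (le_trans (ler_wpM2r _ (ler_norm C)))// ler_wpM2l.
have /choice[h hP] : forall N, exists h : dual Y, `|h| <= c^-1 /\
    forall a, h (T a) = tau N a.
  move=> N; apply: dual_extend; first by rewrite invr_ge0 ltW.
  move=> a; rewrite (le_trans (tau1 _ _))// ler_pdivlMl//.
  by have /andP[] := bT a.
have hl N : h N l = 1.
  apply: (cvg_unique _ (ul (h N))) => //.
  apply: (@cvg_trans _ (cst (1 : R^o) @ \oo)); last exact: cvg_cst.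
  apply: near_eq_cvg; exists N => // n /= Nn.
  by rewrite (hP N).2 taue// (leq_trans Nn).
have cr : convex_set (range T : set Y).
  apply/convex_setP => _ _ t _ [a _ <-] [b _ <-].
  by exists (t *: a + (1 - t) *: b); rewrite // linearP linearZ.
have [|_ [a _ <-] aT] := weak_cvg_dist cr (u := T \o e \o s) _ ul
    (d := c / 2) (divr_gt0 c0 (ltr0Sn _ _)).
  by move=> n; exists (e (s n)).
have /cvgrPdist_lt/(_ (2^-1))[|N _ /(_ N (leqnn _))/=] := tau0 a.
  by rewrite invr_gt0.
rewrite sub0r normrN -(hP N).2.
have : `|h N (T a - l)| <= 2^-1.
  rewrite (le_trans (ler_dual_norm _ _))//.
  rewrite (le_trans (ler_wpM2r _ (hP N).1))// ler_pdivrMl//.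
  exact: ltW.
rewrite linearB/= hl ltr_norml ler_norml; lra.
Qed.

End embeddings.

(** * No c_0 or l_1 in weakly sequentially compact spaces; how embeddings defeat the FPP *)

Section sequence_space_copies.
Context {R : realType}.

Lemma linear_exists (V W : lmodType R) (f : V -> W) : linear f ->
  exists L : {linear V -> W}, L =1 f.
Proof.
move=> fl; pose L : {linear V -> W} :=
  HB.pack f (GRing.isLinear.Build R V W *:%R f fl).
by exists L.
Qed.

Lemma ell1_coord_linear (i : nat) :
  exists L : {linear ell1 R -> R^o}, forall a, L a = a i.
Proof. by apply: linear_exists => t a b. Qed.

Lemma c0_coord_linear (i : nat) :
  exists L : {linear c0 R -> R^o}, forall a, L a = a i.
Proof. by apply: linear_exists => t a b. Qed.

Lemma weakly_seq_compact_no_c0 (Y : normedModType R) :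
  weakly_seq_compact Y -> ~ contains_isomorphic_copy (c0 R) Y.
Proof.
have /choice[tau tauE] := c0_coord_linear.
(* The summing basis of c_0, paired with the coordinate functionals. *)
have /choice[e eE] : forall n : nat, exists a : c0 R, forall i, a i = (i <= n)%:R.
  move=> n; apply: c0_exists.
  apply: (@cvg_trans _ (cst (0 : R) @ \oo)); last exact: cvg_cst.
  by apply: near_eq_cvg; exists n.+1 => // i /= ni; rewrite leqNgt ni.
apply: (@weakly_seq_compact_no_copy _ _ _ e 1 tau).
- move=> n; apply: c0_norm_le => i; rewrite eE.
  by case: leqP; rewrite ?normr1 ?normr0.
- by move=> N a; rewrite tauE; exact: ler_c0_norm.
- by move=> N n Nn; rewrite tauE eE Nn.
- move=> a; rewrite (_ : (fun N => _) = (a : nat -> R^o)); first exact: c0_cvg.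
  by apply/funext => N; rewrite tauE.
Qed.

Lemma weakly_seq_compact_no_ell1 (Y : normedModType R) :
  weakly_seq_compact Y -> ~ contains_isomorphic_copy (ell1 R) Y.
Proof.
have cv (a : ell1 R) : cvgn (series (a : nat -> R^o)).
  by apply: (@normed_cvg R R^o); exact: ell1_cvg.
pose s (a : ell1 R) := limn (series (a : nat -> R^o)).
have sl : linear (s : ell1 R -> R^o).
  move=> t a b; apply/cvg_lim => //.
  rewrite (_ : series _ = (fun n => t *: series (a : nat -> R^o) n) \+
      series (b : nat -> R^o)).
    by apply: cvgD; [apply: cvgZl_tmp|]; exact: cv.
  by apply/funext => n; rewrite /series/= scaler_sumr -big_split.
(* In l_1 the unit vectors are paired with the tail sums over indices at least [N]. *)
have /choice[tau tauE] : forall N, exists L : {linear ell1 R -> R^o},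
    forall a, L a = s a - \sum_(0 <= i < N) a i.
  move=> N; apply: linear_exists => t a b; rewrite sl scalerBr addrACA -opprD.
  by rewrite scaler_sumr -big_split.
have partial n : forall k, \sum_(0 <= i < k) (i == n)%:R = (n < k)%:R :> R.
  elim=> [|k IH]; first by rewrite big_nil ltn0.
  rewrite big_nat_recr//= IH ltnS [(n <= k)%N]leq_eqVlt eq_sym.
  by case: eqP => [->|]; rewrite ?ltnn ?add0r ?addr0.
have /choice[e eE] : forall n : nat, exists a : ell1 R, forall i, a i = (i == n)%:R.
  move=> n; apply: ell1_exists; apply: (@bounded_series_ell1 _ _ 1) => k.
  under eq_bigr do rewrite normr_nat; rewrite partial.
  by case: ltnP.
apply: (@weakly_seq_compact_no_copy _ _ _ e 1 tau).
- move=> n; apply: ell1_norm_le => k.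
  by under eq_bigr do rewrite eE normr_nat; rewrite partial; case: ltnP.
- move=> N a; rewrite tauE.
  have : `|series (a : nat -> R^o) n - \sum_(0 <= i < N) a i| @[n --> \oo] -->
      `|s a - \sum_(0 <= i < N) a i|.
    by apply: cvg_norm; apply: (@cvgB _ R^o); [exact: cv|exact: cvg_cst].
  move=> /cvgr_to_le; apply; exists N => // n /= Nn.
  rewrite /series/= (big_cat_nat _ Nn)//= addrAC subrr add0r.
  rewrite (le_trans (ler_norm_sum _ _ _))// (le_trans _ (ell1_norm_ge a n))//.
  by rewrite [leRHS](big_cat_nat _ Nn)//= lerDr sumr_ge0.
- move=> N n Nn; rewrite tauE.
  have -> : s (e n) = 1.
    apply/cvg_lim => //; apply: (@cvg_trans _ (cst (1 : R^o) @ \oo)); last exact: cvg_cst.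
    apply: near_eq_cvg; exists n.+1 => // k /= nk.
    by rewrite /series/=; under eq_bigr do rewrite eE; rewrite partial nk.
  by under eq_bigr do rewrite eE; rewrite partial ltnNge Nn subr0.
- move=> a; rewrite -(subrr (s a)).
  rewrite (_ : (fun N => _) = (fun N => (s a : R^o) - series (a : nat -> R^o) N)).
    by apply: cvgB; [exact: cvg_cst|exact: cv].
  by apply/funext => N; rewrite tauE.
Qed.

Lemma contains_copy_of_bounds (E Y : normedModType R) (S : {linear E -> Y}) :
  (forall a, `|a| <= `|S a| <= 2 * `|a|) -> contains_isomorphic_copy E Y.
Proof.
move=> Sb; apply/contains_isomorphic_copyP; exists S, 1, 2; split=> // a.
by rewrite mul1r.
Qed.

(** [tau] is transported by [S] to the image of [K], which is closed because [K] is complete and [S]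
    is bounded below. Nonexpansiveness is measured in the norm of [Y], so [S] need only be an
    isomorphism. *)
Lemma no_fpp_of_bounds (E Y : normedModType R) (S : {linear E -> Y})
    (K : set E) (tau : E -> E) :
  (forall a, `|a| <= `|S a| <= 2 * `|a|) ->
  K !=set0 -> convex_set K -> (forall a, K a -> `|a| <= 1) ->
  (forall a : nat -> E, (forall n, K (a n)) ->
    (forall e, 0 < e -> exists N, forall n, (N <= n)%N -> `|a N - a n| < e) ->
    exists2 b, K b & a n @[n --> \oo] --> b) ->
  (forall a, K a -> K (tau a)) -> (forall a, K a -> tau a <> a) ->
  (forall a b, K a -> K b -> `|S (tau a - tau b)| <= `|S (a - b)|) ->
  ~ fixed_point_property Y.
Proof.
move=> Sb [a0 Ka0] cK K1 Kcomp Ktau tau_nfix tau_ne fpp.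
have Sinj a b : S a = S b -> a = b.
  move=> Sab; apply/subr0_eq/normr0_eq0/le_anti; rewrite normr_ge0 andbT.
  by have /andP[+ _] := Sb (a - b); rewrite linearB Sab subrr normr0.
pose Si y := xget 0 [set a | S a = y].
have SiK a : Si (S a) = a.
  by apply: Sinj; rewrite /Si; case: xgetP => [y _ ->//|/(_ a)/=].
have [||||||_ [a Ka <-]] := fpp (S @` K) _ _ _ _ (fun y => S (tau (Si y))) _ _.
- by exists (S a0), a0.
- move=> y cy; have /choice[a aP] : forall n : nat,
      exists a, K a /\ `|y - S a| < n.+1%:R^-1.
    move=> n; have n0 : (0 : R) < n.+1%:R^-1 by rewrite invr_gt0.
    have [_ [[a Ka <-]]] := cy (ball y n.+1%:R^-1) (nbhsx_ballx _ _ n0).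
    by rewrite -ball_normE/= => ?; exists a.
  have Say : S (a n) @[n --> \oo] --> y.
    apply/cvgrPdist_lt => e e0; near=> n.
    rewrite (lt_trans (aP n).2)//; near: n.
    exact: near_infty_natSinv_lt (PosNum e0).
  have [||b Kb ab] := Kcomp a.
  + by move=> n; case: (aP n).
  + move=> e e0.
    have /cvgrPdist_lt/(_ (e / 2))[|N _ yN] := Say; first by rewrite divr_gt0.
    exists N => n Nn; have /andP[/le_lt_trans-> //] := Sb (a N - a n).
    rewrite linearB; have := ler_normD (S (a N) - y) (y - S (a n)).
    rewrite addrA subrK (distrC _ y); have := yN N (leqnn _); have := yN n Nn => /=.
    lra.
  exists b => //; apply: (cvg_unique _ _ Say) => //.
  apply/cvgrPdist_lt => e e0.
  have /cvgrPdist_lt/(_ (e / 2)) := ab; rewrite divr_gt0// => /(_ isT).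
  apply: filterS => n abn; rewrite -linearB.
  by have /andP[_] := Sb (b - a n); lra.
- exists 2; split => // x x2 _ [a Ka <-] /=.
  have /andP[_ /le_trans->//] := Sb a.
  by rewrite (le_trans _ (ltW x2))// -[leRHS]mulr1 ler_pM2l// K1.
- apply/convex_setP => _ _ t t01 [a Ka <-] [b Kb <-].
  exists (t *: a + (1 - t) *: b); last by rewrite linearP linearZ.
  by have /convex_setP := cK; apply.
- by move=> _ [a Ka <-]; exists (tau a); rewrite ?SiK//; exact: Ktau.
- move=> _ _ [a Ka <-] [b Kb <-]; rewrite !SiK -!linearB; exact: tau_ne.
- by rewrite SiK => /Sinj; exact: tau_nfix.
Unshelve. all: by end_near. Qed.

End sequence_space_copies.

(** * Completeness of the dual *)

Section dual_complete.
Context {R : realType} (X : normedModType R).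

Lemma dual_complete (F : set_system (dual X)) :
  ProperFilter F -> cauchy F -> cvg F.
Proof.
move=> FF Fc.
have Fex e : 0 < e -> exists f : dual X, F [set g | `|f - g| < e].
  move=> e0; have [f Ff] := (cauchyP F).1 Fc e e0.
  by exists f; apply: filterS Ff => g; rewrite -ball_normE.
have ev x : cvg ((fun f : dual X => f x : R^o) @ F).
  apply/cauchy_cvgP/cauchy_exP => e e0.
  have e'0 : 0 < e / (`|x| + 1) by rewrite divr_gt0// ltr_wpDl.
  have [f Ff] := Fex _ e'0; exists (f x : R^o).
  apply: (@filterS _ F _ _ _ _ Ff) => g /= fg.
  rewrite -ball_normE/= -[_ - _]/((f - g) x) (le_lt_trans (ler_dual_norm _ _))//.
  apply: (@le_lt_trans _ _ (`|f - g| * (`|x| + 1))).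
    by rewrite -dual_normE ler_wpM2l// lerDl.
  by rewrite -ltr_pdivlMr// ltr_wpDl.
pose g x := lim ((fun f : dual X => f x : R^o) @ F).
have gl : linear (g : X -> R^o).
  move=> a x y; apply/cvg_lim => //.
  rewrite (_ : (fun _ => _) = (fun f : dual X => a *: (f x : R^o) + f y)).
    by apply: cvgD; [apply: cvgZl_tmp|]; exact: ev.
  by apply/funext => f; rewrite linearP.
have gf (f : dual X) e : F [set h | `|f - h| < e] -> forall x, `|g x - f x| <= e * `|x|.
  move=> Ff x.
  have : `|(h : dual X) x - f x| @[h --> F] --> `|g x - f x|.
    by apply: cvg_norm; apply: (@cvgB _ R^o); [exact: ev|exact: cvg_cst].
  move=> /cvgr_to_le; apply; apply: filterS Ff => h /= fh.
  rewrite distrC -[_ - _]/((f - h) x) (le_trans (ler_dual_norm _ _))// ler_wpM2r//.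
  exact: ltW.
have [f1 Ff1] := Fex 1 ltr01.
have [|x|h [_ hE]] := @dual_of_linear R X g (1 + `|f1|) _ gl.
- by rewrite addr_ge0.
- rewrite mulrDl -[g x](subrK (f1 x)) lerD//.
    exact: le_trans (ler_norm _) (gf f1 1 Ff1 x).
  exact: le_trans (ler_norm _) (ler_dual_norm f1 x).
apply/cvg_ex; exists h; apply/cvgrPdist_lt => e e0.
have e3 : 0 < e / 3 by rewrite divr_gt0.
have [f Ff] := Fex _ e3; apply: filterS (Ff) => k /= fk.
have : `|h - f| <= e / 3.
  rewrite dual_normE; apply: dual_norm_le => x x1.
  have -> : (h - f) x = g x - f x by rewrite -hE.
  by rewrite (le_trans (gf f _ Ff x))// ler_piMr// ltW.
have := ler_normD (h - f) (f - k); rewrite addrA subrK; lra.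
Qed.

HB.instance Definition _ := Uniform_isComplete.Build (dual X) dual_complete.

End dual_complete.

(** * From [c0_like] to a sequence with an upper c_0-estimate *)

Section c0_like.
Context {R : realType}.

(* In c_0, take [z] to be a basis vector with a large index. *)
Definition c0_like (Y : normedModType R) := forall (s : seq Y) (eps : R),
  0 < eps -> (forall x, x \in s -> `|x| <= 1) ->
  exists2 z : Y, 1 - eps <= `|z| & forall x, x \in s -> `|x + z| <= 1 + eps.

(** The definition rescaled to radius [c], with [eps = c' / c - 1]; applying it to [s] together with
    its negatives covers both signs. *)
Lemma c0_like_step (Y : normedModType R) (s : seq Y) (c c' : R) :
  c0_like Y -> 0 < c -> c < c' -> (forall x, x \in s -> `|x| <= c) ->
  exists2 y : Y, 2 * c - c' <= `|y| &
    forall x, x \in s -> `|x + y| <= c' /\ `|x - y| <= c'.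
Proof.
move=> HY c0 cc' sc.
pose t := [seq c^-1 *: x | x <- s] ++ [seq - (c^-1 *: x) | x <- s].
have [||z z1 zt] := HY t (c' / c - 1).
- by rewrite subr_gt0 ltr_pdivlMr// mul1r.
- move=> x; rewrite mem_cat => /orP[] /mapP[{}x xs ->]; rewrite ?normrN normrZ;
  by rewrite gtr0_norm ?invr_gt0// ler_pdivrMl// mulr1 sc.
have scale x : c * `|c^-1 *: x + z| = `|x + c *: z|.
  by rewrite -{1}(gtr0_norm c0) -normrZ scalerDr scalerA divff ?gt_eqF// scale1r.
exists (c *: z) => [|x xs].
  rewrite normrZ gtr0_norm//.
  have -> : 2 * c - c' = c * (1 - (c' / c - 1)) by field; rewrite gt_eqF.
  by rewrite ler_pM2l.
have cE : c * (1 + (c' / c - 1)) = c' by field; rewrite gt_eqF.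
split.
  by rewrite -scale -cE ler_pM2l// zt// mem_cat map_f.
rewrite -normrN opprB addrC -scale -cE ler_pM2l// scalerN zt// mem_cat.
by rewrite (map_f (fun x => - (c^-1 *: x)))// orbT.
Qed.

Lemma ler_norm_segment (V : normedModType R) (x y : V) (a M : R) : `|a| <= 1 ->
  `|x + y| <= M -> `|x - y| <= M -> `|x + a *: y| <= M.
Proof.
move=> a1 xyM xNyM; have [a0 a0'] : 0 <= (1 + a) / 2 /\ 0 <= (1 - a) / 2.
  by move: a1; rewrite ler_norml; lra.
have -> : x + a *: y = ((1 + a) / 2) *: (x + y) + ((1 - a) / 2) *: (x - y).
  rewrite !scalerDr scalerN addrACA -scalerDl -scalerBl.
  have -> : (1 + a) / 2 + (1 - a) / 2 = 1 by field.
  have -> : (1 + a) / 2 - (1 - a) / 2 = a by field.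
  by rewrite scale1r.
rewrite (le_trans (ler_normD _ _))//
  (normrZ ((1 + a) / 2)) (normrZ ((1 - a) / 2)) (ger0_norm a0) (ger0_norm a0').
have -> : M = (1 + a) / 2 * M + (1 - a) / 2 * M by field.
by apply: lerD; apply: ler_wpM2l.
Qed.

(** The vectors are chosen one by one so that all signed sums of the first [k] stay in the ball of
    radius [1 - theta k]; the decrease of [theta] leaves room for the next vector. *)
Lemma c0_like_seq (Y : normedModType R) (theta : nat -> R) : c0_like Y ->
  (forall k, 0 < theta k < 1) -> (forall k, theta k.+1 < theta k) ->
  exists y : nat -> Y, (forall k, 1 - 2 * theta k <= `|y k|) /\
    forall n (a : nat -> R) (A : R), 0 <= A ->
      (forall i, (i < n)%N -> `|a i| <= A) ->
      `|\sum_(0 <= i < n) a i *: y i| <= A.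
Proof.
move=> HY th01 thd.
have /choice[Z ZP] : forall p : seq Y * nat, exists y : Y,
    (forall x, x \in p.1 -> `|x| <= 1 - theta p.2) ->
    1 - 2 * theta p.2 <= `|y| /\ forall x, x \in p.1 ->
    `|x + y| <= 1 - theta p.2.+1 /\ `|x - y| <= 1 - theta p.2.+1.
  move=> [s k] /=; have [sk|nsk] := pselect (forall x, x \in s -> `|x| <= 1 - theta k).
    have /andP[tk0 tk1] := th01 k; have /andP[tk'0 _] := th01 k.+1.
    have [||y yk ys] := c0_like_step HY _ _ sk (c' := 1 - theta k.+1).
    - by rewrite subr_gt0.
    - by have := thd k; lra.
    - by exists y => _; split=> //; lra.
  by exists 0 => /nsk.
(* [L k] lists all sums of the first [k] vectors with signs, the next vector being picked by [Z]
   from this list. *)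
pose fix L k := if k is k'.+1 then
  [seq x + Z (L k', k') | x <- L k'] ++ [seq x - Z (L k', k') | x <- L k'] else [:: 0].
pose y k := Z (L k, k).
have Lk k : forall x, x \in L k -> `|x| <= 1 - theta k.
  elim: k => [x|k IH x] /=.
    by rewrite mem_seq1 => /eqP->; rewrite normr0; have := th01 0%N; lra.
  have [_ yL] := ZP (L k, k) IH.
  by rewrite mem_cat => /orP[] /mapP[{}x xs ->]; have [] := yL x xs.
(* By convexity in each coefficient, signs are the worst case; [w] collects the terms still carrying
   general coefficients in earlier stages of the induction. *)
have dom k (a : nat -> R) : (forall i, (i < k)%N -> `|a i| <= 1) -> forall w M,
    (forall x, x \in L k -> `|x + w| <= M) ->
    `|\sum_(0 <= i < k) a i *: y i + w| <= M.
  elim: k => [_|k IH ak] w M LM.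
    by rewrite big_nil; apply: LM; rewrite mem_seq1.
  rewrite big_nat_recr//= -addrA; apply: IH => [i ik|x xL].
    by apply: ak; rewrite ltnS ltnW.
  rewrite addrCA addrC; apply: ler_norm_segment; first exact: ak.
    rewrite addrAC; apply: LM; rewrite /= mem_cat.
    by rewrite (map_f (fun x => x + Z (L k, k))).
  rewrite addrAC; apply: LM; rewrite /= mem_cat.
  by rewrite (map_f (fun x => x - Z (L k, k)))// orbT.
exists y; split=> [k|n a A A0 aA]; first by have [] := ZP (L k, k) (@Lk k).
have [A00|An0] := eqVneq A 0.
  rewrite big_nat big1 ?normr0// => i /andP[_ /aA]; rewrite A00 normr_le0 => /eqP->.
  by rewrite scale0r.
have Ap : 0 < A by rewrite lt0r An0.
have -> : \sum_(0 <= i < n) a i *: y i = A *: \sum_(0 <= i < n) (A^-1 * a i) *: y i.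
  by rewrite scaler_sumr; apply: eq_bigr => i _; rewrite scalerA mulVKf.
rewrite normrZ ger0_norm// ler_piMr//.
rewrite -[\sum_(_ <= _ < _) _]addr0; apply: dom => [i ni|x xL].
  by rewrite normrM gtr0_norm ?invr_gt0// ler_pdivrMl// mulr1 aA.
by rewrite addr0 (le_trans (Lk _ _ xL))//; have := th01 n; lra.
Qed.

End c0_like.

(** * Lower estimates, and the weights that make shifts contractive *)

Section c0_like_consequences.
Context {R : realType}.

Lemma sum_update (V : lmodType R) (y : nat -> V) (a : nat -> R) (m n : nat) (b : R) :
  (m < n)%N ->
  \sum_(0 <= i < n) (if i == m then b else a i) *: y i =
  \sum_(0 <= i < n) a i *: y i + (b - a m) *: y m.
Proof.
move=> mn; have -> : (b - a m) *: y m =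
    \sum_(0 <= i < n) (if i == m then (b - a i) *: y i else 0).
  by rewrite -big_mkcond big_nat1_eq mn.
rewrite -big_split/=; apply: eq_bigr => i _.
by case: eqP => [->|_]; rewrite ?addr0// -scalerDl addrC subrK.
Qed.

Lemma ler_sum_single (F : nat -> R) (m n : nat) : (m < n)%N ->
  (forall i, 0 <= F i) -> F m <= \sum_(0 <= i < n) F i.
Proof.
move=> mn F0; have {1}-> : F m = \sum_(0 <= i < n) (if i == m then F i else 0).
  by rewrite -big_mkcond big_nat1_eq mn.
by apply: ler_sum => i _; case: ifP.
Qed.

Lemma argmax_nat (a : nat -> R) (n : nat) : (0 < n)%N ->
  exists2 j, (j < n)%N & forall i, (i < n)%N -> a i <= a j.
Proof.
case: n => // n _; elim: n => [|n [j jn aj]].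
  by exists 0%N => // i; rewrite ltnS leqn0 => /eqP->.
have [H|/ltW H] := leP (a n.+1) (a j).
  by exists j => [|i]; [exact: ltnW|rewrite ltnS leq_eqVlt => /predU1P[->//|/aj]].
exists n.+1 => // i; rewrite ltnS leq_eqVlt => /predU1P[->//|/aj].
by move=> /le_trans; apply.
Qed.

(* [lambda] decreases to 1, and the ratio [lambda m / lambda m.+1 = 1 + 8 * theta m]
   absorbs the distortion of a c_0-basis with [|y m| >= 1 - 2 * theta m]: this is
   what makes the right shift of the basis [lambda m *: y m] contractive. *)
Definition theta (m : nat) : R := (8 * (m.+1%:R * m.+3%:R))^-1.
Definition lambda (m : nat) : R := m.+2%:R / m.+1%:R.

Lemma theta_bounds m : 0 < theta m <= 24^-1.
Proof.
rewrite invr_gt0 !mulr_gt0//= lef_pV2 ?posrE ?mulr_gt0//.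
have -> : (24 : R) = 8 * (1 * 3) by ring.
by rewrite ler_pM2l//; apply: ler_pM; rewrite ?ler1n ?ler_nat.
Qed.

Lemma theta_decreasing m : theta m.+1 < theta m.
Proof.
rewrite ltf_pV2 ?posrE ?mulr_gt0// ltr_pM2l// ltr_pM// ltr_nat//.
Qed.

Lemma lambda_bounds m : 1 <= lambda m <= 2.
Proof.
rewrite ler_pdivlMr// ler_pdivrMr// mul1r ler_nat leqnSn/= -natrM ler_nat.
by rewrite mul2n -addnn addSn addnS !ltnS leq_addl.
Qed.

(** This is [(m+2)^2 = (m+1)(m+3) + 1]. *)
Lemma lambda_theta m : lambda m = (1 + 8 * theta m) * lambda m.+1.
Proof.
rewrite /lambda /theta; field.
by rewrite !lt0r_neq0 ?ltr_wpDr.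
Qed.

(** It reduces to [(1 + 8 * theta m) * (1 - 4 * theta m) >= 1]. It serves the shift of the dual
    basis, whose distortion is [1 - 4 * theta m]. *)
Lemma lambda_theta_le m : lambda m.+1 <= lambda m * (1 - 4 * theta m).
Proof.
have /andP[l1 _] := lambda_bounds m.+1; have /andP[t0 t24] := theta_bounds m.
rewrite (lambda_theta m) mulrAC ler_peMl ?(le_trans ler01)//.
have : theta m * (1 - 8 * theta m) >= 0 by rewrite mulr_ge0 ?(ltW t0)//; lra.
by nra.
Qed.

Definition c0_basic (Y : normedModType R) (y : nat -> Y) :=
  (forall m, 1 - 2 * theta m <= `|y m|) /\
  forall n (a : nat -> R) (A : R), 0 <= A -> (forall i, (i < n)%N -> `|a i| <= A) ->
    `|\sum_(0 <= i < n) a i *: y i| <= A.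

Lemma c0_like_basic (Y : normedModType R) : c0_like Y ->
  exists y : nat -> Y, c0_basic y.
Proof.
move=> HY; apply: (c0_like_seq HY) => k; last exact: theta_decreasing.
have /andP[-> /=] := theta_bounds k.
by move/le_lt_trans; apply; rewrite invf_lt1// ltr1n.
Qed.

Section c0_basic_theory.
Variables (Y : normedModType R) (y : nat -> Y).
Hypothesis yP : c0_basic y.

Lemma c0_basic_norm m : `|y m| <= 1.
Proof.
have := yP.2 m.+1 (fun i => (i == m)%:R) 1 ler01.
rewrite big_nat_recr//= eqxx scale1r big_nat big1 ?add0r; last first.
  by move=> i /andP[_ im]; rewrite ltn_eqF// scale0r.
by apply => i _; case: eqP; rewrite ?normr1 ?normr0.
Qed.

(** Setting the [k]-th coefficient to [b] of modulus [A] with the sign of [a k], and negating all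
    the others, yields a sum of norm at most [A]. Added to [x + (b - a k) *: y k] it gives
    [2 b *: y k], whose norm is almost [2 A], so [x] is almost as large as [a k]. *)
Lemma c0_basic_lower n (a : nat -> R) m : (m < n)%N ->
  `|a m| <= (1 + 8 * theta m) * `|\sum_(0 <= i < n) a i *: y i|.
Proof.
move=> mn; set x := \sum_(_ <= _ < _) _.
have [j jn aj] := argmax_nat (fun i => `|a i|) (leq_ltn_trans (leq0n m) mn).
set A := `|a j| in aj.
have key k : (k < n)%N -> `|a k| - 4 * theta k * A <= `|x|.
  move=> kn; pose b := if 0 <= a k then A else - A.
  have A0 : 0 <= A by exact: normr_ge0.
  have bA : `|b| = A by rewrite /b; case: ifP; rewrite ?normrN normr_id.
  have bak : `|b - a k| = A - `|a k|.
    have := aj k kn; rewrite /b; have [ak0|ak0] := lerP 0 (a k).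
      by rewrite (ger0_norm ak0) => akA; rewrite ger0_norm// subr_ge0.
    by rewrite (ltr0_norm ak0) => akA; rewrite ler0_norm; lra.
  have X2 : `|b *: y k *+ 2 - (x + (b - a k) *: y k)| <= A.
    have -> : b *: y k *+ 2 - (x + (b - a k) *: y k) =
        \sum_(0 <= i < n) (if i == k then b else - a i) *: y i.
      rewrite (sum_update y (fun i => - a i) b kn).
      under eq_bigr do rewrite scaleNr; rewrite sumrN -/x opprK opprD addrCA.
      congr (_ + _); rewrite mulr2n -scalerDl -scalerBl; congr (_ *: _); ring.
    apply: yP.2 => // i ni; case: eqP => _; first by rewrite bA.
    by rewrite normrN aj.
  have := ler_normD (b *: y k *+ 2 - (x + (b - a k) *: y k)) (x + (b - a k) *: y k).
  rewrite subrK normrMn normrZ bA => H1.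
  have := ler_normD x ((b - a k) *: y k); rewrite normrZ bak => H2.
  have := yP.1 k; have := c0_basic_norm k; have := aj k kn; nra.
(* [key] at the largest coefficient bounds [A] by the norm of [x]; used again at [m], it leaves the
   error [8 * theta m]. *)
have xA : A <= 2 * `|x|.
  have /andP[_ tj] := theta_bounds j.
  have := ler_wpM2r (normr_ge0 (a j)) tj; have := key j jn; have := normr_ge0 x.
  by rewrite -/A; lra.
have /andP[/ltW tm _] := theta_bounds m.
have := ler_wpM2l tm xA; have := key m mn; lra.
Qed.

(** The distortion turns [lambda m] into [lambda m.+1], exactly the weight that [a m] receives after
    a right shift. *)
Lemma c0_basic_scaled_lower n (a : nat -> R) m : (m < n)%N ->
  lambda m.+1 * `|a m| <= `|\sum_(0 <= i < n) a i *: (lambda i *: y i)|.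
Proof.
move=> mn; under eq_bigr do rewrite scalerA.
have := c0_basic_lower (fun i => a i * lambda i) mn.
set x := \sum_(_ <= _ < _) _; have /andP[l0 _] := lambda_bounds m.
have /andP[l0' _] := lambda_bounds m.+1; have /andP[t0 _] := theta_bounds m.
rewrite normrM (ger0_norm (le_trans ler01 l0)) {1}lambda_theta mulrCA.
by rewrite ler_pM2l ?[lambda m.+1 * _]mulrC// ltr_wpDr ?mulr_ge0// ltW.
Qed.

End c0_basic_theory.

Lemma cvg_seq_norm (V : normedModType R) (u : nat -> V) (l : V) :
  u n @[n --> \oo] --> l -> `|u n| @[n --> \oo] --> `|l|.
Proof. exact: cvg_norm. Qed.

Section basis_map.
Variables (E : normedModType R) (Y : normedModType R).
Variables (cf : nat -> {linear E -> R^o}) (e : nat -> Y).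

Lemma basis_map : (forall a, cvgn (series (fun i => cf i a *: e i))) ->
  exists S : {linear E -> Y},
    forall a, series (fun i => cf i a *: e i) @ \oo --> S a.
Proof.
move=> cv; have [|S SE] := @linear_exists R E Y
    (fun a => limn (series (fun i => cf i a *: e i))).
  move=> t a b; apply/cvg_lim => //.
  rewrite (_ : series _ = (fun n => t *: series (fun i => cf i a *: e i) n) \+
      series (fun i => cf i b *: e i)).
    by apply: cvgD; [apply: cvgZl_tmp|]; exact: cv.
  apply/funext => n; rewrite /series/= scaler_sumr -big_split.
  by apply: eq_bigr => i _; rewrite linearP scalerDl scalerA.
by exists S => a; rewrite SE; exact: cv.
Qed.

Variable S : {linear E -> Y}.
Hypothesis SP : forall a, series (fun i => cf i a *: e i) @ \oo --> S a.

Lemma basis_map_le a (M : R) :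
  (forall n, `|\sum_(0 <= i < n) cf i a *: e i| <= M) -> `|S a| <= M.
Proof.
by move=> H; apply: (cvgr_to_le (cvg_seq_norm (@SP a))); exact: nearW.
Qed.

Lemma basis_map_ge a (M : R) (k : nat) :
  (forall n, (k <= n)%N -> M <= `|\sum_(0 <= i < n) cf i a *: e i|) -> M <= `|S a|.
Proof.
by move=> H; apply: (cvgr_to_ge (cvg_seq_norm (@SP a))); exists k.
Qed.

Lemma basis_map_shift a b :
  (forall n (c : nat -> R), `|\sum_(0 <= i < n) c i *: e i.+1| <=
     `|\sum_(0 <= i < n) c i *: e i|) ->
  cf 0%N b = 0 -> (forall i, cf i.+1 b = cf i a) -> `|S b| <= `|S a|.
Proof.
move=> He b0 bS.
have Sb := cvg_subseq (s := Datatypes.S)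
  (u := fun n => `|series (fun i => cf i b *: e i) n|)
  leqnSn (cvg_seq_norm (@SP b)).
apply: (ler_cvg_to Sb (cvg_seq_norm (@SP a))); apply: nearW => n /=.
rewrite /series/= big_nat_recl//= b0 scale0r add0r.
by under eq_bigr do rewrite bS; exact: He.
Qed.

End basis_map.

End c0_like_consequences.

(** * Copies of c_0 in the space and of l_1 in its dual, with contractive shifts *)

Section c0_like_copies.
Context {R : realType}.

Lemma c0_basic_map (Y : completeNormedModType R) (y : nat -> Y) : c0_basic y ->
  exists S : {linear c0 R -> Y}, (forall a, `|a| <= `|S a| <= 2 * `|a|) /\
    forall a b : c0 R, b 0%N = 0 -> (forall i, b i.+1 = a i) -> `|S b| <= `|S a|.
Proof.
move=> yP; pose e i := lambda i *: y i.
have [cf cfE] := choice (@c0_coord_linear R).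
have up n (a : nat -> R) (A : R) : 0 <= A -> (forall i, (i < n)%N -> `|a i| <= A) ->
    `|\sum_(0 <= i < n) a i *: e i| <= 2 * A.
  move=> A0 aA; under eq_bigr do rewrite scalerA.
  apply: yP.2 => [|i ni]; first by rewrite mulr_ge0.
  have /andP[l1 l2] := @lambda_bounds R i.
  by rewrite normrM mulrC ler_pM// ?aA// ger0_norm// (le_trans ler01).
have low n (a : nat -> R) m : (m < n)%N ->
    @lambda R m.+1 * `|a m| <= `|\sum_(0 <= i < n) a i *: e i|.
  exact: c0_basic_scaled_lower.
have sh n (a : nat -> R) :
    `|\sum_(0 <= i < n) a i *: e i.+1| <= `|\sum_(0 <= i < n) a i *: e i|.
  (* The coefficients of the shifted sum with respect to [y]; each is bounded by the norm of the
     unshifted sum through [low]. *)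
  pose b j := if j is j'.+1 then a j' * @lambda R j else 0.
  have -> : \sum_(0 <= i < n) a i *: e i.+1 = \sum_(0 <= j < n.+1) b j *: y j.
    rewrite big_nat_recl//= scale0r add0r; apply: eq_bigr => i _.
    by rewrite scalerA.
  apply: yP.2 => // -[_|j]; first by rewrite normr0.
  rewrite ltnS => jn; rewrite (le_trans _ (low n a j jn))// normrM mulrC.
  by rewrite ger0_norm//; have /andP[/(le_trans ler01)] := @lambda_bounds R j.+1.
have cv a : cvgn (series (fun i => cf i a *: e i)).
  apply: cauchy_cvgn => r r0; have r4 : 0 < r / 4 by rewrite divr_gt0.
  have /cvgrPdist_lt/(_ _ r4)[N _ aN] := @c0_cvg R a.
  exists N => n Nn; pose b i := if (N <= i)%N then cf i a else 0.
  have -> : series (fun i => cf i a *: e i) n =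
      series (fun i => cf i a *: e i) N + \sum_(0 <= i < n) b i *: e i.
    rewrite /series/= (big_cat_nat _ Nn)//=; congr (_ + _).
    have bN : \sum_(0 <= i < N) b i *: e i = 0.
      by rewrite big_nat big1// => i /andP[_ iN]; rewrite /b leqNgt iN scale0r.
    rewrite [RHS](big_cat_nat _ Nn)//= bN add0r.
    by apply: eq_big_nat => i /andP[Ni _]; rewrite /b Ni.
  rewrite opprD addrA subrr add0r normrN.
  rewrite (le_lt_trans (up _ _ _ (ltW r4) _))//; last by lra.
  move=> i _; rewrite /b; case: leqP => [Ni|_]; last by rewrite normr0 ltW.
  by have := aN i Ni; rewrite /= sub0r normrN cfE => /ltW.
have [S SP] := basis_map cv.
exists S; split=> [a|a b b0 bS]; last first.
  by apply: (basis_map_shift SP sh); [rewrite cfE|move=> i; rewrite !cfE].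
apply/andP; split.
  apply: c0_norm_le => m; apply: (basis_map_ge SP (k := m.+1)) => n mn.
  rewrite -cfE (le_trans _ (low n (fun i => cf i a) m mn))// ler_peMl//.
  by have /andP[] := @lambda_bounds R m.+1.
apply: (basis_map_le SP) => n; apply: up => // i _.
by rewrite cfE; exact: ler_c0_norm.
Qed.

Lemma c0_basic_copy (Y : completeNormedModType R) (y : nat -> Y) : c0_basic y ->
  contains_isomorphic_copy (c0 R) Y.
Proof. by move=> /c0_basic_map[S [Sb _]]; exact: contains_copy_of_bounds Sb. Qed.

(* The affine map [t |-> (1, t 0, t 1, ...)] has no fixed point in c_0. *)
Lemma c0_basic_no_fpp (Y : completeNormedModType R) (y : nat -> Y) : c0_basic y ->
  ~ fixed_point_property Y.
Proof.
move=> /c0_basic_map[S [Sb Ssh]].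
pose K : set (c0 R) := [set t | forall i, 0 <= t i <= 1].
have /choice[tau tauE] : forall t : c0 R, exists t' : c0 R,
    forall i, t' i = if i is i'.+1 then t i' else 1.
  move=> t; apply: c0_exists; rewrite -cvg_shiftS/=; exact: c0_cvg.
apply: (no_fpp_of_bounds (K := K) (tau := tau) Sb).
- by exists 0 => i; rewrite lexx ler01.
- apply/convex_setP => a b t /andP[t0 t1] aK bK i.
  have /andP[a0 a1] := aK i; have /andP[b0 b1] := bK i.
  rewrite c0DE !c0ZE; apply/andP; split; first by rewrite addr_ge0// mulr_ge0// subr_ge0.
  have := ler_wpM2l t0 a1; have := ler_wpM2l (_ : 0 <= 1 - t) b1; rewrite subr_ge0.
  by move=> /(_ t1); lra.
- move=> a aK; apply: c0_norm_le => i; have /andP[a0 a1] := aK i.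
  by rewrite ger0_norm.
- move=> a aK /c0_complete[b ab]; exists b => // i.
  have bi : a n i @[n --> \oo] --> (b i : R).
    apply/cvgrPdist_lt => r r0; have /cvgrPdist_lt/(_ _ r0) := ab.
    by apply: filterS => n; exact: le_lt_trans (ler_c0_norm (b - a n) i).
  apply/andP; split.
    by apply: (cvgr_to_ge bi); apply: nearW => n; have /andP[] := aK n i.
  by apply: (cvgr_to_le bi); apply: nearW => n; have /andP[] := aK n i.
- by move=> a aK [|i]; rewrite tauE ?ler01 ?lexx//; exact: aK.
- move=> a aK taua; have a1 i : a i = 1.
    by elim: i => [|i IH]; rewrite -taua tauE.
  have /cvgrPdist_lt/(_ 1 ltr01)[N _ /(_ N (leqnn _))] := @c0_cvg R a.
  by rewrite /= a1 sub0r normrN normr1 ltxx.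
- move=> a b aK bK; apply: Ssh => [|i]; rewrite c0DE c0NE !tauE ?subrr//.
Qed.

Lemma ell1_norm_unique (c : ell1 R) (l : R) :
  \sum_(0 <= i < n) `|c i| @[n --> \oo] --> l -> `|c| = l.
Proof.
move=> cl; have cn := @ell1_norm_cvg R c.
exact: (cvg_unique (@norm_hausdorff _ R) cn cl).
Qed.

(** The last clause asks for a contractive right shift in the norm of [Y] itself, which the
    two-sided l_1-estimate alone would not give. *)
Definition ell1_basic (Y : normedModType R) (g : nat -> Y) :=
  [/\ forall i, `|g i| <= 2,
      forall n (a : nat -> R), \sum_(0 <= i < n) `|a i| <= `|\sum_(0 <= i < n) a i *: g i|
    & forall n (a : nat -> R),
      `|\sum_(0 <= i < n) a i *: g i.+1| <= `|\sum_(0 <= i < n) a i *: g i|].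

Lemma ell1_basic_map (Y : completeNormedModType R) (g : nat -> Y) : ell1_basic g ->
  exists S : {linear ell1 R -> Y}, (forall a, `|a| <= `|S a| <= 2 * `|a|) /\
    forall a b : ell1 R, b 0%N = 0 -> (forall i, b i.+1 = a i) -> `|S b| <= `|S a|.
Proof.
move=> [g2 low sh]; have [cf cfE] := choice (@ell1_coord_linear R).
have up (a : ell1 R) n : \sum_(0 <= i < n) `|cf i a *: g i| <= 2 * `|a|.
  have aE : \sum_(0 <= i < n) 2 * `|a i| <= 2 * `|a|.
    by rewrite -mulr_sumr ler_pM2l// ell1_norm_ge.
  rewrite (le_trans _ aE)//; apply: ler_sum => i _.
  by rewrite normrZ cfE mulrC ler_wpM2r.
have cv a : cvgn (series (fun i => cf i a *: g i)).
  apply: normed_cvg; apply: nondecreasing_is_cvgn.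
    by apply: nondecreasing_series => i _ _; exact: normr_ge0.
  by exists (2 * `|a|) => _ [n _ <-]; exact: up.
have [S SP] := basis_map cv.
exists S; split=> [a|a b b0 bS]; last first.
  by apply: (basis_map_shift SP sh); [rewrite cfE|move=> i; rewrite !cfE].
apply/andP; split.
  apply: ell1_norm_le => m; apply: (basis_map_ge SP (k := m)) => n mn.
  rewrite (le_trans _ (low n _))// (big_cat_nat _ mn)//=.
  by under eq_bigr do rewrite -cfE; rewrite lerDl sumr_ge0.
apply: (basis_map_le SP) => n.
by rewrite (le_trans _ (up a n))// ler_norm_sum.
Qed.

Lemma ell1_basic_copy (Y : completeNormedModType R) (g : nat -> Y) : ell1_basic g ->
  contains_isomorphic_copy (ell1 R) Y.
Proof. by move=> /ell1_basic_map[S [Sb _]]; exact: contains_copy_of_bounds Sb. Qed.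

(* The right shift has no fixed point on the positive face of the unit sphere of
   l_1. *)
Lemma ell1_basic_no_fpp (Y : completeNormedModType R) (g : nat -> Y) : ell1_basic g ->
  ~ fixed_point_property Y.
Proof.
move=> /ell1_basic_map[S [Sb Ssh]].
pose K : set (ell1 R) := [set t : ell1 R | (forall i, 0 <= t i) /\ `|t| = 1].
have shift_sum (t : ell1 R) n :
    \sum_(0 <= i < n.+1) `|if i is i'.+1 then t i' else 0| = \sum_(0 <= i < n) `|t i|.
  by rewrite big_nat_recl//= normr0 add0r.
have /choice[tau tauE] : forall t : ell1 R, exists t' : ell1 R,
    forall i, t' i = if i is i'.+1 then t i' else 0.
  move=> t; apply: ell1_exists; apply: (@bounded_series_ell1 _ _ `|t|) => -[|n].
    by rewrite big_nil.
  by rewrite shift_sum ell1_norm_ge.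
have tau_norm (t : ell1 R) : `|tau t| = `|t|.
  apply/le_anti/andP; split; apply: ell1_norm_le => n.
    case: n => [|n]; first by rewrite big_nil.
    by under eq_bigr do rewrite tauE; rewrite shift_sum ell1_norm_ge.
  rewrite -shift_sum (le_trans _ (ell1_norm_ge (tau t) n.+1))//.
  by apply: ler_sum => i _; rewrite tauE.
apply: (no_fpp_of_bounds (K := K) (tau := tau) Sb).
- have [d dE] : exists d : ell1 R, forall i, d i = (i == 0%N)%:R.
    apply: ell1_exists; apply: (@bounded_series_ell1 _ _ 1) => -[|n].
      by rewrite big_nil.
    by rewrite big_nat_recl//= normr1 big1 ?addr0// => i _; rewrite normr0.
  exists d; split=> [i|]; first by rewrite dE.
  apply/le_anti/andP; split.
    apply: ell1_norm_le => -[|n]; first by rewrite big_nil.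
    under eq_bigr do rewrite dE.
    by rewrite big_nat_recl//= normr1 big1 ?addr0// => i _; rewrite normr0.
  by rewrite (le_trans _ (ell1_norm_ge d 1))// big_nat1 dE normr1.
- apply/convex_setP => a b t /andP[t0 t1] [a0 a1] [b0 b1]; split=> [i|].
    by rewrite ell1DE !ell1ZE addr_ge0// mulr_ge0// subr_ge0.
  have H : \sum_(0 <= i < n) `|(t *: a + (1 - t) *: b) i| @[n --> \oo] -->
      t * 1 + (1 - t) * 1.
    rewrite (_ : (fun n => _) = (fun n => t * (\sum_(0 <= i < n) `|a i|) +
        (1 - t) * (\sum_(0 <= i < n) `|b i|))).
      apply: (@cvgD _ R^o); apply: (@cvgZl_tmp _ R^o).
        by rewrite -a1; exact: ell1_norm_cvg.
      by rewrite -b1; exact: ell1_norm_cvg.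
    apply/funext => n; rewrite !mulr_sumr -big_split; apply: eq_bigr => i _.
    rewrite ell1DE !ell1ZE !ger0_norm//.
    by rewrite addr_ge0// mulr_ge0// subr_ge0.
  by rewrite (ell1_norm_unique H); ring.
- by move=> a [_ ->].
- move=> a aK /ell1_complete[b ab]; exists b => //; split=> [i|].
    have bi : a n i @[n --> \oo] --> (b i : R).
      apply/cvgrPdist_lt => r r0; have /cvgrPdist_lt/(_ _ r0) := ab.
      by apply: filterS => n; exact: le_lt_trans (ell1_coord (b - a n) i).
    by apply: (cvgr_to_ge bi); apply: nearW => n; have [] := aK n.
  have := cvg_seq_norm ab; rewrite (_ : (fun n => _) = cst (1 : R)).
    by move=> H; apply: (cvg_unique _ H (cvg_cst _)).
  by apply/funext => n; have [_ ->] := aK n.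
- by move=> a [a0 a1]; split; rewrite ?tau_norm// => -[|i]; rewrite tauE.
- move=> a [a0 a1] taua; have ai i : a i = 0.
    by elim: i => [|i IH]; rewrite -taua tauE.
  have : a = 0 by apply: ell1E.
  by move=> aE; move: a1; rewrite aE normr0 => /esym/eqP; rewrite oner_eq0.
- move=> a b aK bK; apply: Ssh => [|i]; rewrite ell1DE ell1NE !tauE ?subrr//.
Qed.

(** Let [h m] norm [y m]. The upper c_0-estimate gives [sum_i |h m (y i)| <= 1], of which the term
    at [m] already takes almost everything; so the [h m] are nearly biorthogonal to the [y i], and a
    sum with signs tests the l_1-norm. *)
Lemma c0_basic_dual (Y : normedModType R) (y : nat -> Y) : c0_basic y ->
  exists g : nat -> dual Y, ell1_basic g.
Proof.
move=> yP; have /choice[h hP] := fun m => norming_functional (y m).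
have hsum n m : (m < n)%N -> \sum_(0 <= i < n) `|h m (y i)| <= 1.
  move=> mn; have H : `|\sum_(0 <= i < n) Num.sg (h m (y i)) *: y i| <= 1.
    apply: yP.2 => // i _.
    by rewrite normr_sg; case: eqP => _; rewrite ?ler01.
  have := ler_dual_norm (h m) (\sum_(0 <= i < n) Num.sg (h m (y i)) *: y i).
  rewrite linear_sum/= => H1.
  have -> : \sum_(0 <= i < n) `|h m (y i)| =
      \sum_(0 <= i < n) h m (Num.sg (h m (y i)) *: y i).
    by apply: eq_bigr => i _; rewrite linearZ/= -[RHS]/(_ * _) -normrEsg.
  rewrite (le_trans (ler_norm _))// (le_trans H1)// mulr_ile1//.
    exact: dual_norm_ge0.
  exact: (hP m).1.
have low n (a : nat -> R) :
    \sum_(0 <= m < n) `|a m| * (1 - 4 * @theta R m) <= `|\sum_(0 <= m < n) a m *: h m|.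
  have dual_sumE x : (\sum_(0 <= m < n) a m *: h m) x = \sum_(0 <= m < n) a m * h m x.
    by rewrite (@big_morph _ _ (fun f : dual Y => f x) 0 +%R)//.
  pose x := \sum_(0 <= i < n) Num.sg (a i) *: y i.
  have x1 : `|x| <= 1.
    apply: yP.2 => // i _.
    by rewrite normr_sg; case: eqP => _; rewrite ?ler01.
  apply: le_trans (le_trans (ler_norm _) (ler_dual_norm1 _ x1)).
  rewrite dual_sumE [leLHS]big_nat [leRHS]big_nat; apply: ler_sum => m /andP[_ mn].
  (* All [F i] are nonnegative and [F m] is twice [|a m| * |y m|]; bounding the total of the [F i]
     below by [F m] gives [a m * h m x >= |a m| * (2 * |y m| - 1)]. *)
  pose F i := a m * (Num.sg (a i) * h m (y i)) + `|a m| * `|h m (y i)|.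
  have F0 i : 0 <= F i.
    have : `|a m * (Num.sg (a i) * h m (y i))| <= `|a m| * `|h m (y i)|.
      rewrite !normrM ler_wpM2l// ler_piMl// normr_sg.
      by case: eqP => _; rewrite ?ler01.
    by rewrite ler_norml /F; lra.
  have hx : a m * h m x + `|a m| * (\sum_(0 <= i < n) `|h m (y i)|) =
      \sum_(0 <= i < n) F i.
    rewrite big_split/= -!mulr_sumr linear_sum/=; congr (_ * _ + _).
    by apply: eq_bigr => i _; rewrite linearZ.
  have := ler_sum_single mn F0; rewrite -hx /F (hP m).2 normr_id mulrA.
  rewrite [a m * Num.sg _]mulrC -normrEsg.
  have := ler_wpM2l (normr_ge0 (a m)) (hsum n m mn).
  by have := ler_wpM2l (normr_ge0 (a m)) (yP.1 m); lra.
exists (fun m => @lambda R m *: h m); split.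
- move=> m; have /andP[l1 l2] := @lambda_bounds R m.
  rewrite normrZ ger0_norm ?(le_trans ler01)// -[leRHS]mulr1 ler_pM//.
    exact: le_trans ler01 l1.
  exact: (hP m).1.
- move=> n a; under [X in _ <= `|X|]eq_bigr do rewrite scalerA.
  rewrite (le_trans _ (low n _))//; apply: ler_sum => m _.
  have := @lambda_theta_le R m; have /andP[l1 _] := @lambda_bounds R m.
  have /andP[l1' _] := @lambda_bounds R m.+1 => H.
  rewrite normrM -mulrA (ger0_norm (le_trans ler01 l1)) ler_peMr//.
  exact: le_trans l1' H.
- move=> n a; under [X in _ <= `|X|]eq_bigr do rewrite scalerA.
  rewrite (le_trans _ (low n _))// (le_trans (ler_norm_sum _ _ _))//.
  apply: ler_sum => m _; have := @lambda_theta_le R m.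
  have /andP[l1 _] := @lambda_bounds R m; have /andP[l1' _] := @lambda_bounds R m.+1 => H.
  rewrite (normrZ (a m)) (normrZ (lambda m.+1)) (normrM (a m))
    (ger0_norm (le_trans ler01 l1))
    (ger0_norm (le_trans ler01 l1')).
  rewrite -[leRHS]mulrA; apply: ler_wpM2l => //; apply: le_trans H; rewrite ler_piMr//.
    exact: le_trans ler01 l1'.
  exact: (hP m.+1).1.
Qed.

End c0_like_copies.

(** * Fixed points from property (M) in spaces that are not [c0_like] *)

Section fixed_points.
Context {R : realType} (Y : completeNormedModType R).

(** The comparison of upper limits, expressed through eventual bounds. *)
Definition property_M := forall (x : nat -> Y) (u v : Y) (c : R),
  weak_cvg x 0 -> `|u| <= `|v| -> (\forall n \near \oo, `|x n + v| <= c) ->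
  forall e, 0 < e -> \forall n \near \oo, `|x n + u| <= c + e.

Variable T : Y -> Y.

Definition invariant_set (D : set Y) :=
  [/\ D !=set0, closed D, (exists M : R, forall x, D x -> `|x| <= M),
      convex_set D & set_fun D D T] /\ nonexpansive_on D T.

Definition approx_fixed (y : nat -> Y) (D : set Y) :=
  (forall n, D (y n)) /\ (forall e, 0 < e -> \forall n \near \oo, `|y n - T (y n)| <= e).

(** The contraction [(1 - t) T + t x0] has a fixed point [z] with [z - T z = t (x0 - T z)]; taking
    [t = 1/(n+2)] keeps [t < 1] for all [n]. *)
Lemma approx_fixed_exists D : invariant_set D -> exists y, approx_fixed y D.
Proof.
move=> [[[x0 Dx0] clD [M DM] cD TD] neT].
have M0 : 0 <= M by rewrite (le_trans _ (DM _ Dx0)).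
suff /choice[y yP] : forall n, exists z, D z /\ `|z - T z| <= n.+2%:R^-1 * (2 * M).
  exists y; split=> [n|e e0]; first by case: (yP n).
  have e'0 : 0 < e / (2 * M + 1) by rewrite divr_gt0// ltr_wpDl// mulr_ge0.
  near=> n; rewrite (le_trans (yP n).2)//.
  have : n.+2%:R^-1 <= e / (2 * M + 1).
    apply: (@le_trans _ _ n.+1%:R^-1); first by rewrite lef_pV2 ?posrE// ler_nat.
    by apply/ltW; near: n; exact: near_infty_natSinv_lt (PosNum e'0).
  rewrite ler_pdivlMr ?ltr_wpDl ?mulr_ge0//.
  by apply: le_trans; rewrite ler_wpM2l// lerDl.
move=> n; pose t : R := n.+2%:R^-1.
have t0 : 0 < t by rewrite invr_gt0.
have t1 : t < 1 by rewrite invf_lt1// ltr1n.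
pose f x := (1 - t) *: T x + (1 - (1 - t)) *: x0.
have fD : set_fun D D f.
  move=> x Dx; have /convex_setP := cD; apply => //; last exact: TD.
  by rewrite subr_ge0 ltW//= gerBl ltW.
pose F : {fun D >-> D} := HB.pack f (isFun.Build _ _ D D f fD).
have q0 : 0 <= 1 - t by rewrite subr_ge0 ltW.
have [||z Dz zE] := @banach_fixed_point R Y D F _ clD.
- exists (NngNum q0); split; first by rewrite /= gtrBl.
  move=> [x x'] [/= Dx Dx']; change (`|f x - f x'| <= (1 - t) * `|x - x'|).
  rewrite /f; set w := _ *: x0; rewrite opprD addrACA subrr addr0 -scalerBr.
  by rewrite normrZ ger0_norm// ler_wpM2l// neT.
- by exists x0.
exists z; split=> //; rewrite {1}zE /= /f.
have -> : (1 - t) *: T z + (1 - (1 - t)) *: x0 - T z = t *: (x0 - T z).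
  rewrite scalerBl scale1r subKr scalerBr addrAC [T z - _]addrC addrK.
  by rewrite addrC.
rewrite normrZ gtr0_norm// ler_pM2l// (le_trans (ler_normB _ _))//.
by rewrite mulr2n mulrDl mul1r; apply: lerD; apply: DM => //; exact: TD.
Unshelve. all: by end_near. Qed.

Hypothesis wY : weakly_seq_compact Y.

Lemma approx_fixed_weak_cvg D : invariant_set D ->
  exists y l, [/\ approx_fixed y D, weak_cvg y l & D l].
Proof.
move=> invD; have [y [Dy yT]] := approx_fixed_exists invD.
have [[_ clD [M DM] cD _] _] := invD.
have [s [l [ns yl]]] := wY (fun n => DM _ (Dy n)).
have Dys n : D (y (s n)) by [].
exists (y \o s), l; split=> //; last exact: (weak_cvg_closed cD clD Dys yl).
by split=> // e e0; exact: near_subseq (yT e e0).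
Qed.

Definition asymptotic_radius D (r : R) := exists y l,
  [/\ approx_fixed y D, weak_cvg y l & \forall n \near \oo, `|y n - l| <= r].

Definition asymptotic_ball (y : nat -> Y) (r : R) D := [set x | D x /\
  forall e, 0 < e -> \forall n \near \oo, `|y n - x| <= r + e].

(** Invariance under [T] comes from [|y n - T x| <= |y n - T (y n)| + |y n - x|], where the first
    term tends to 0; the weak limit [l] makes the set nonempty. *)
Lemma asymptotic_ball_invariant D y l r : invariant_set D -> approx_fixed y D ->
  D l -> (\forall n \near \oo, `|y n - l| <= r) ->
  invariant_set (asymptotic_ball y r D).
Proof.
move=> [[_ clD [M DM] cD TD] neT] [Dy yT] Dl yl.
split; last by move=> x x' [Dx _] [Dx' _]; exact: neT.
split.
- exists l; split=> // e e0; apply: filterS yl => n /le_trans; apply.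
  by rewrite lerDl ltW.
- rewrite closure_id; apply/seteqP; split; first exact: subset_closure.
  move=> x cx; split.
    by apply: clD => B Bx; have [x' [[Dx' _] Bx']] := cx B Bx; exists x'.
  move=> e e0; have e2 : 0 < e / 2 by rewrite divr_gt0.
  have [x' [[_ yx']]] := cx (ball x (e / 2)) (nbhsx_ballx _ _ e2).
  rewrite -ball_normE/= => xx'; apply: filterS (yx' _ e2) => n yn.
  have := ler_normD (y n - x') (x' - x); rewrite addrA subrK (distrC x' x).
  by lra.
- by exists M => x [/DM].
- have /convex_setP := cD => cD'; apply/convex_setP => x x' t t01 [Dx yx] [Dx' yx'].
  split=> [|e e0]; first exact: cD'.
  have /andP[t0 t1] := t01; near=> n.
  have -> : y n - (t *: x + (1 - t) *: x') = t *: (y n - x) + (1 - t) *: (y n - x').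
    rewrite !scalerBr addrACA -scalerDl -opprD.
    have -> : t + (1 - t) = 1 by ring.
    by rewrite scale1r.
  rewrite (le_trans (ler_normD _ _))// !normrZ !ger0_norm// ?subr_ge0//.
  have -> : r + e = t * (r + e) + (1 - t) * (r + e) by ring.
  apply: lerD; apply: ler_wpM2l; rewrite ?subr_ge0//.
    by near: n; exact: yx.
  by near: n; exact: yx'.
- move=> x [Dx yx]; split=> [|e e0]; first exact: TD.
  have e2 : 0 < e / 2 by rewrite divr_gt0.
  near=> n; have := ler_normD (y n - T (y n)) (T (y n) - T x).
  rewrite addrA subrK; have := neT _ _ (Dy n) Dx.
  have : `|y n - T (y n)| <= e / 2 by near: n; exact: yT.
  have : `|y n - x| <= r + e / 2 by near: n; exact: yx.
  lra.
Unshelve. all: by end_near. Qed.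

Hypothesis MY : property_M.

Lemma weak_cvg_sub (y : nat -> Y) (l : Y) :
  weak_cvg y l -> weak_cvg (fun n => y n - l) 0.
Proof.
move=> yl f; rewrite linear0 -(subrr (f l)).
rewrite (_ : (fun n => _) = (fun n => (f (y n) : R^o) - f l)).
  by apply: cvgB; [exact: yl|exact: cvg_cst].
by apply/funext => n; rewrite linearB.
Qed.

(* If the smallest radius [c] is positive, then on the asymptotic ball of an
   almost optimal sequence [y] one finds [x] with [|x - l|] close to [c], so
   property (M) makes [y - l] orthogonal to the ball of radius [c]. *)
Lemma asymptotic_radius_small D : invariant_set D -> ~ c0_like Y ->
  forall eta, 0 < eta -> exists2 r, r < eta & asymptotic_radius D r.
Proof.
move=> invD nc0 eta eta0; apply: contrapT => noR; apply: nc0.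
have Reta r : asymptotic_radius D r -> eta <= r.
  by move=> Dr; rewrite leNgt; apply/negP => ?; apply: noR; exists r.
have [[_ _ [M DM] _ _] _] := invD.
have R0 : asymptotic_radius D !=set0.
  have [y [l [yD yl Dl]]] := approx_fixed_weak_cvg invD.
  exists (M + M), y, l; split=> //; apply: nearW => n.
  by rewrite (le_trans (ler_normB _ _))// lerD// DM//; exact: yD.1.
have Rinf : has_inf (asymptotic_radius D) by split=> //; exists eta.
pose c := inf (asymptotic_radius D).
have c0 : 0 < c by rewrite (lt_le_trans eta0)//; exact: lb_le_inf.
have Rc r : asymptotic_radius D r -> c <= r.
  by move=> Dr; apply: ge_inf => //; exists eta.
(* [e <= c / 4] keeps [c - e] positive, and [e <= c * eps / 4] turns the final bound [c + 4 * e]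
   into [c * (1 + eps)]. *)
move=> s eps eps0 s1; pose e := c * Num.min eps 1 / 4.
have [e0 ec eeps] : [/\ 0 < e, e <= c / 4 & e <= c * eps / 4].
  split; first by rewrite divr_gt0// mulr_gt0// lt_min eps0 ltr01.
    by rewrite ler_pM2r// ler_piMr ?(ltW c0)// ge_min lexx orbT.
  by rewrite ler_pM2r// ler_pM2l// ge_min lexx.
have [r [y [l [yD yl ynl]]] rc] := inf_adherent e0 Rinf.
rewrite -/c in rc.
have Dl : D l.
  by have [[_ clD _ cD _] _] := invD; exact: (weak_cvg_closed cD clD yD.1 yl).
have invA := asymptotic_ball_invariant invD yD Dl ynl.
(* Otherwise approximate fixed points [z n -> m] in the asymptotic ball satisfy
   [|z n - l| <= c - e]; property (M) replaces the shift [m - l] by 0 and yields the radius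
   [c - e / 2], below the infimum. *)
have [x [Dx yx] xl] : exists2 x, asymptotic_ball y r D x & c - e < `|x - l|.
  apply: contrapT => noA.
  have Al x : asymptotic_ball y r D x -> `|x - l| <= c - e.
    by move=> Ax; rewrite leNgt; apply/negP => ?; apply: noA; exists x.
  have [z [m [zA zm Am]]] := approx_fixed_weak_cvg invA.
  have zM : \forall n \near \oo, `|z n - m + 0| <= c - e + e / 2.
    apply: (MY (weak_cvg_sub zm) (v := m - l)); last by rewrite divr_gt0.
      by rewrite normr0.
    by apply: nearW => n; rewrite addrA subrK; apply: Al; exact: zA.1.
  have : c <= c - e + e / 2.
    apply: Rc; exists z, m; split=> //.
      by split=> [n|]; [have [] := zA.1 n|exact: zA.2].
    by apply: filterS zM => n; rewrite addr0.
  by lra.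
have yu u : `|u| <= c - e -> \forall n \near \oo, `|y n - l + u| <= c + 3 * e.
  move=> uc; have : \forall n \near \oo, `|y n - l + u| <= r + e + e.
    apply: (MY (weak_cvg_sub yl) (v := l - x)) => //.
      by rewrite distrC (le_trans uc)// ltW.
    by under eq_near do rewrite addrA subrK; exact: yx.
  apply: filterS => n; lra.
have sy : \forall n \near \oo, forall x, x \in s ->
    `|y n - l + (c - e) *: x| <= c + 3 * e.
  apply: near_seq => x' x's; apply: yu; rewrite normrZ ger0_norm; last lra.
  by rewrite ler_piMr ?s1//; lra.
(* Minimality applied to [y] itself: its distance to [l] exceeds [c - e] infinitely often, and such
   a term becomes [z]. *)
have ny : ~ (\forall n \near \oo, `|y n - l| <= c - e).
  by move=> H; have : c <= c - e; [apply: Rc; exists y, l|lra].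
have [n [yn1 yn2]] : exists n, c - e < `|y n - l| /\
    forall x, x \in s -> `|y n - l + (c - e) *: x| <= c + 3 * e.
  apply: contrapT => H; apply: ny; apply: filterS sy => n Hn.
  by rewrite leNgt; apply/negP => ?; apply: H; exists n.
exists (c^-1 *: (y n - l)).
  rewrite normrZ gtr0_norm ?invr_gt0// ler_pdivlMl//.
  by rewrite mulrBr mulr1; lra.
move=> x' x's; rewrite -(ler_pM2l c0) -{1}(gtr0_norm c0) -normrZ scalerDr.
rewrite scalerA divff ?gt_eqF// scale1r.
have -> : c *: x' + (y n - l) = (y n - l + (c - e) *: x') + e *: x'.
  by rewrite addrC -[RHS]addrA -scalerDl subrK.
rewrite (le_trans (ler_normD _ _))//.
have : `|e *: x'| <= e by rewrite normrZ gtr0_norm// ler_piMr ?s1// ltW.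
have := yn2 x' x's; lra.
Qed.

(** Two points of an asymptotic ball of radius [r < eta / 8] are both close to the same late
    [y n]. *)
Lemma small_invariant_subset D eta : invariant_set D -> ~ c0_like Y -> 0 < eta ->
  exists A, [/\ invariant_set A, A `<=` D & forall x x', A x -> A x' -> `|x - x'| <= eta].
Proof.
move=> invD nc0 eta0.
have e8 : 0 < eta / 8 by rewrite divr_gt0.
have [r reta [y [l [yD yl ynl]]]] := asymptotic_radius_small invD nc0 e8.
have Dl : D l.
  by have [[_ clD _ cD _] _] := invD; exact: (weak_cvg_closed cD clD yD.1 yl).
exists (asymptotic_ball y r D); split.
- exact: asymptotic_ball_invariant ynl.
- by move=> x [].
- move=> x x' [_ yx] [_ yx'].
  near \oo => n; have := ler_normD (x - y n) (y n - x'); rewrite addrA subrK.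
  rewrite (distrC x (y n)).
  have : `|y n - x| <= r + eta / 8 by near: n; exact: yx.
  have : `|y n - x'| <= r + eta / 8 by near: n; exact: yx'.
  lra.
Unshelve. all: by end_near. Qed.

(** Cantor intersection: nested invariant sets of vanishing diameter share a point, and its image
    lies in all of them too. *)
Lemma fixed_point_of_invariant C : invariant_set C -> ~ c0_like Y ->
  exists2 x, C x & T x = x.
Proof.
move=> invC nc0.
have /choice[F FP] : forall p : set Y * nat, exists A, invariant_set p.1 ->
    [/\ invariant_set A, A `<=` p.1
      & forall x x', A x -> A x' -> `|x - x'| <= p.2.+1%:R^-1].
  move=> [D k]; have [invD|ninvD] := pselect (invariant_set D); last by exists D.
  have [|A AP] := @small_invariant_subset D k.+1%:R^-1 invD nc0.
    by rewrite invr_gt0.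
  by exists A.
pose fix D k := if k is k'.+1 then F (D k', k') else C.
have invDk k : invariant_set (D k).
  by elim: k => [//|k IH]; have [] := FP (D k, k) IH.
have Dsub k n : D (k + n)%N `<=` D k.
  elim: n => [|n IH]; first by rewrite addn0.
  rewrite addnS; apply: subset_trans IH.
  by have [_ ] := FP (D (k + n)%N, (k + n)%N) (invDk _).
have Ddiam k x x' : D k.+1 x -> D k.+1 x' -> `|x - x'| <= k.+1%:R^-1.
  by have [_ _] := FP (D k, k) (invDk k); apply.
have /choice[x xD] : forall k, exists x, D k x.
  by move=> k; have [[[x Dx] _ _ _ _] _] := invDk k; exists x.
have xDk k n : (k <= n)%N -> D k (x n).
  by move=> kn; have := Dsub k (n - k)%N (x n); rewrite subnKC//; apply.
have cx : cvgn x.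
  apply: cauchy_cvgn => e e0.
  have [N _ NE] := near_infty_natSinv_lt (PosNum e0).
  exists N.+1 => n Nn; apply: le_lt_trans (NE N (leqnn _)).
  by apply: Ddiam; exact: xDk.
have Dl k : D k (limn x).
  have [[_ clD _ _ _] _] := invDk k.
  have xk : \forall n \near \oo, D k (x n) by exists k => // n /= kn; exact: xDk.
  exact: (closed_cvg _ clD xk _ cx).
exists (limn x); first exact: (Dl 0%N).
apply/eqP; rewrite -subr_eq0 -normr_le0; apply/ler_addgt0Pl => e e0.
have [N _ NE] := near_infty_natSinv_lt (PosNum e0).
rewrite addr0 (le_trans _ (ltW (NE N (leqnn _))))//.
by have [[_ _ _ _ TD] _] := invDk N.+1; apply: Ddiam => //; exact: TD.
Qed.

End fixed_points.

Lemma fpp_of_property_M {R : realType} (Y : completeNormedModType R) :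
  weakly_seq_compact Y -> property_M Y -> ~ c0_like Y -> fixed_point_property Y.
Proof.
move=> wY MY nc0 C C0 clC bC cC T TC neT.
apply: (fixed_point_of_invariant wY MY) => //; split=> //; split=> //.
have [M [_ CM]] := bC.
by exists (M + 1) => x Cx; apply: CM Cx; rewrite ltrDl.
Qed.

(** * Property (M) for the dual and for the space, from property (M-star) *)

Section Mstar.
Context {R : realType} (X : completeNormedModType R).
Hypotheses (sepX : separable_space X) (MstarX : property_Mstar X).

Lemma limn_esup_near_le (u : nat -> R) (c : R) :
  (\forall n \near \oo, u n <= c) -> (limn_esup (fun n => (u n)%:E) <= c%:E)%E.
Proof.
move=> uc; apply: (@le_trans _ _ (ereal_sup [set (u n)%:E | n in [set n | u n <= c]])).
  by apply: ereal_inf_lbound; exists [set n | u n <= c].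
by apply: ge_ereal_sup => _ [n /= unc <-]; rewrite lee_fin.
Qed.

Lemma limn_esup_le_near (u : nat -> R) (c e : R) : 0 < e ->
  (limn_esup (fun n => (u n)%:E) <= c%:E)%E -> \forall n \near \oo, u n <= c + e.
Proof.
move=> e0 uc; have /ereal_inf_lt[_ [V oV <-] Vc] :
    (limn_esup (fun n => (u n)%:E) < (c + e)%:E)%E.
  by rewrite (le_lt_trans uc)// lte_fin ltrDl.
apply: filterS oV => n Vn; rewrite -lee_fin; apply: le_trans (ltW Vc).
by apply: ereal_sup_ubound; exists n.
Qed.

Lemma Mstar_near (f : nat -> dual X) (u v : dual X) (c : R) :
  weak_star_null f -> `|u| <= `|v| -> (\forall n \near \oo, `|f n + v| <= c) ->
  forall e, 0 < e -> \forall n \near \oo, `|f n + u| <= c + e.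
Proof.
move=> f0 uv fvc e e0; apply: limn_esup_le_near => //.
exact: le_trans (MstarX f0 uv) (limn_esup_near_le fvc).
Qed.

(** Evaluations at points of [X] lie in the bidual, so weakly null sequences of the dual are
    weak-star null. *)
Lemma Mstar_dual_property_M : property_M (dual X).
Proof.
move=> f u v c f0 uv; apply: Mstar_near => // x.
have [phi phiE] := bidual_eval x.
have := f0 phi; rewrite linear0.
by rewrite (_ : (fun n => _) = (fun n => f n x : R^o))//; apply/funext => n.
Qed.

Lemma near_cvg_dist (u : nat -> R) (l e : R) : 0 < e ->
  u n @[n --> \oo] --> l -> \forall n \near \oo, `|l - u n| <= e.
Proof. by move=> e0 /cvgrPdist_le; apply. Qed.

(* Norming functionals of [x n + u] converge weakly* along a subsequence; moving
   their limit [g0] to a functional [g] of smaller norm adapted to [v] costs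
   nothing by property (M-star). *)
Lemma Mstar_property_M : property_M X.
Proof.
move=> x u v c x0 uv xvc e e0; apply: contrapT => /not_near_subseq[s [ns xs]].
have {}xs n : c + e < `|x (s n) + u| by rewrite ltNge; apply/negP/xs.
have /choice[f fP] := fun n => norming_functional (x (s n) + u).
have [t [g0 [nt fg0]]] := separable_alaoglu1 sepX (fun n => (fP n).1).
pose h n := f (t n) - g0; pose z n := x (s (t n)).
have nst n : (n <= s (t n))%N by exact: leq_trans (nt n) (ns _).
have z0 : weak_cvg z 0 by move=> k; exact: (cvg_subseq nst (x0 k)).
have h0 : weak_star_null h.
  move=> y; rewrite -(subrr (g0 y : R^o)).
  by apply: cvgB; [exact: fg0|exact: cvg_cst].
have [k [k1 kv]] := norming_functional v.
(* This [g] is no larger than [g0], yet [g v = |g0| * |v|] dominates [g0 u]. *)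
pose g := `|g0| *: k.
have gg0 : `|g| <= `|g0| by rewrite normrZ normr_id ler_piMr.
have gv : g0 u <= g v.
  rewrite dualZE kv (le_trans (ler_norm _))// (le_trans (ler_dual_norm _ _))//.
  by rewrite ler_wpM2l// dual_norm_ge0.
have c0 : 0 <= c.
  by have [N _ /(_ N (leqnn _))/=] := xvc; apply: le_trans.
have e8 : 0 < e / 8 by rewrite divr_gt0.
have eta0 : 0 < e / 4 / (c + 1) by rewrite !divr_gt0// ltr_wpDl.
have hg : \forall n \near \oo, `|h n + g| <= 1 + e / 4 / (c + 1).
  apply: (Mstar_near h0 gg0) => //; apply: nearW => n.
  by rewrite subrK (fP _).1.
have near_z := near_subseq nst xvc.
near \oo => n.
have H1 : `|g0 u - f (t n) u| <= e / 8 by near: n; exact: near_cvg_dist.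
have H2 : `|g0 0 - g0 (z n)| <= e / 8 by near: n; exact: near_cvg_dist (z0 g0).
have H3 : `|0 - h n v| <= e / 8 by near: n; exact: near_cvg_dist (h0 v).
have H4 : `|g 0 - g (z n)| <= e / 8 by near: n; exact: near_cvg_dist (z0 g).
have H5 : `|h n + g| <= 1 + e / 4 / (c + 1) by near: n.
have H6 : `|z n + v| <= c by near: n.
have H7 : (h n + g) (z n + v) <= (1 + e / 4 / (c + 1)) * c.
  rewrite (le_trans (ler_norm _))// (le_trans (ler_dual_norm _ _))//.
  by rewrite ler_pM// dual_norm_ge0.
have H8 : (1 + e / 4 / (c + 1)) * c <= c + e / 4.
  rewrite mulrDl mul1r lerD2l -[leRHS]mulr1 -mulrA ler_pM2l ?divr_gt0//.
  by rewrite mulrC ler_pdivrMr ?ltr_wpDl// mul1r lerDl.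
(* Up to terms that tend to 0, this value is [|z n + u| + (g v - g0 u)], hence almost at least
   [|z n + u|]. *)
have H9 : (h n + g) (z n + v) =
    f (t n) (z n + u) - f (t n) u - g0 (z n) + h n v + g (z n) + g v.
  have hD : h n (z n + v) = f (t n) (z n) - g0 (z n) + h n v by rewrite linearD.
  have gD : g (z n + v) = g (z n) + g v by rewrite linearD.
  have fD : f (t n) (z n + u) = f (t n) (z n) + f (t n) u by rewrite linearD.
  by rewrite dualDE hD gD fD; ring.
have := xs (t n); rewrite -(fP (t n)).2 -[x (s (t n))]/(z n).
move: H1 H2 H3 H4; rewrite !linear0 !sub0r !normrN !ler_norml.
move: H7; rewrite H9; lra.
Unshelve. all: by end_near. Qed.

End Mstar.

(** * Duality tools for nonreflexive spaces: Riesz, Helly, and splitting of functionals *)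

Section nonreflexive.
Context {R : realType}.

Lemma dual_norm_approx (X : normedModType R) (f : dual X) (e : R) : 0 < e ->
  exists2 x, `|x| <= 1 & `|f| - e <= f x.
Proof.
move=> e0; have [_ [x /= x1 <-] fx] := sup_adherent e0 (dual_has_sup f).
rewrite -/(dual_norm f) -dual_normE in fx.
have [fx0|fx0] := lerP 0 (f x).
  by exists x => //; rewrite ltW// -(ger0_norm fx0).
exists (- x); first by rewrite normrN.
by rewrite linearN ltW// -(ltr0_norm fx0).
Qed.

(** Riesz's lemma for the image of [X] in the bidual: subtract from an unrepresented [phi0] an
    almost nearest evaluation and normalize. *)
Lemma nonreflexive_riesz (X : completeNormedModType R) (e : R) :
  ~ reflexive_space X -> 0 < e < 1 ->
  exists phi : dual (dual X), `|phi| = 1 /\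
    forall x, ~ (forall f : dual X, `|phi f - f x| <= (1 - e) * `|f|).
Proof.
move=> nrX /andP[e0 e1].
have [phi0 phi0P] : exists phi : dual (dual X), forall x, ~ (forall f, phi f = f x).
  apply: contrapT => H; apply: nrX => phi; apply: contrapT => Hphi.
  by apply: H; exists phi => x Hx; apply: Hphi; exists x.
pose D r x := forall f : dual X, `|phi0 f - f x| <= r * `|f|.
pose S := [set r : R | 0 <= r /\ exists x, D r x].
have S0 : S !=set0.
  exists `|phi0|; split => //; exists 0 => f; rewrite linear0 subr0.
  exact: ler_dual_norm.
have Sinf : has_inf S by split=> //; exists 0 => r [].
pose d := inf S.
have dS r : S r -> d <= r by move=> Sr; apply: ge_inf => //; exists 0 => ? [].
have d0 : 0 < d.
  rewrite lt0r lb_le_inf ?andbT//; last by move=> r [].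
  apply/negP => /eqP d0.
  (* At distance 0 the approximants are Cauchy, and by completeness of [X] their limit would
     represent [phi0]. *)
  have /choice[x xD] : forall n, exists x, D n.+1%:R^-1 x.
    move=> n; have n0 : (0 : R) < n.+1%:R^-1 by rewrite invr_gt0.
    have [r [r0 [x rx]]] := inf_adherent n0 Sinf.
    rewrite -/d d0 add0r => /ltW rn; exists x => f.
    by rewrite (le_trans (rx f))// ler_wpM2r.
  have cx : cvgn x.
    apply: cauchy_cvgn => r r0; have r2 : 0 < r / 2 by rewrite divr_gt0.
    have [N _ NE] := near_infty_natSinv_lt (PosNum r2).
    exists N => n Nn; have [f [f1 fx]] := norming_functional (x N - x n).
    rewrite -fx linearB.
    have xk k : (N <= k)%N -> `|phi0 f - f (x k)| < r / 2.
      move=> Nk; apply: le_lt_trans (NE k Nk).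
      by rewrite (le_trans (xD k f))// ler_piMr.
    by have := xk N (leqnn _); have := xk n Nn; rewrite !ltr_norml; lra.
  apply: (phi0P (limn x)) => f; apply/subr0_eq/normr0_eq0/le_anti.
  rewrite normr_ge0 andbT.
  have fx : f (x n) @[n --> \oo] --> (f (limn x) : R^o).
    by apply: cvg_comp cx _; exact: dual_continuous.
  have : `|phi0 f - f (x n)| @[n --> \oo] --> `|phi0 f - f (limn x)|.
    by apply: cvg_norm; apply: (@cvgB _ R^o); [exact: cvg_cst|].
  move=> H; apply/ler_addgt0Pl => r r0; rewrite addr0.
  apply: (cvgr_to_le H); near=> n; rewrite (le_trans (xD n f))//.
  apply: (@le_trans _ _ (n.+1%:R^-1 * (`|f| + 1))); first by rewrite ler_wpM2l// lerDl.
  rewrite -ler_pdivlMr ?ltr_wpDl//; apply/ltW; near: n.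
  have r'0 : 0 < r / (`|f| + 1) by rewrite divr_gt0// ltr_wpDl.
  exact: near_infty_natSinv_lt (PosNum r'0).
have e10 : 0 < 1 - e by rewrite subr_gt0.
have [r [r0 [x0 rx0]] rd] : exists2 r, S r & r < d / (1 - e).
  have de : 0 < d / (1 - e) - d.
    by rewrite subr_gt0 ltr_pdivlMr// gtr_pMr// gtrBl.
  have [r Sr rd] := inf_adherent de Sinf.
  by exists r; rewrite // -/d addrC subrK in rd *.
have [Jx JxE] := bidual_eval x0.
pose psi := phi0 - Jx.
have psiE f : psi f = phi0 f - f x0 by rewrite -JxE.
have psid : d <= `|psi|.
  by apply: dS; split=> //; exists x0 => f; rewrite -psiE; exact: ler_dual_norm.
have psir : `|psi| <= r.
  rewrite dual_normE; apply: dual_norm_le => f f1; rewrite psiE.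
  by rewrite (le_trans (rx0 f))// ler_piMr.
have psi0 : 0 < `|psi| by exact: lt_le_trans psid.
exists (`|psi|^-1 *: psi); split.
  by rewrite normrZ normfV normr_id mulVf ?gt_eqF.
move=> x xP; have : d <= (1 - e) * `|psi|.
  apply: dS; split; first by rewrite mulr_ge0// ltW.
  exists (x0 + `|psi| *: x) => f.
  have -> : phi0 f - f (x0 + `|psi| *: x) = `|psi| * ((`|psi|^-1 *: psi) f - f x).
    rewrite dualZE mulrBr mulVKf ?gt_eqF// psiE linearD linearZ/= opprD addrA.
    by [].
  rewrite normrM normr_id (le_trans (ler_wpM2l (ltW psi0) (xP f)))//.
  by rewrite mulrCA mulrA.
move: rd; rewrite ltr_pdivlMr// mulrC => rd.
apply/negP; rewrite -ltNge (le_lt_trans _ rd)// ler_pM2l//.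
Unshelve. all: by end_near. Qed.

(** Induction on [s]: unless [x] is redundant, some [f0] vanishes on the tail but not at [x], and
    subtracting [psi f0 / f0 x] times evaluation at [x] reduces to the tail. *)
Lemma annihilator_span (X : normedModType R) (s : seq X) (psi : dual X -> R) :
  linear (psi : dual X -> R^o) ->
  (forall f : dual X, (forall x, x \in s -> f x = 0) -> psi f = 0) ->
  exists x, forall f : dual X, psi f = f x.
Proof.
elim: s psi => [|x s IH] psi psil psi0.
  by exists 0 => f; rewrite linear0 psi0.
have [Hx|nHx] := pselect (forall f : dual X, (forall y, y \in s -> f y = 0) -> f x = 0).
  apply: IH => // f fs; apply: psi0 => y; rewrite in_cons => /predU1P[->|/fs//].
  exact: Hx.
have [f0 f0s f0x] : exists2 f0 : dual X, (forall y, y \in s -> f0 y = 0) & f0 x != 0.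
  apply: contrapT => H; apply: nHx => f fs; apply/eqP/negPn/negP => fx.
  by apply: H; exists f.
pose c := psi f0 / f0 x.
have [||y yE] := IH (fun f => psi f - c * f x).
- move=> a f g; rewrite psil dualDE dualZE /GRing.scale/=; ring.
- move=> f fs; apply/eqP; rewrite subr_eq0; apply/eqP.
  have := psi0 (- (f x / f0 x) *: f0 + f).
  rewrite psil => H; apply/eqP; rewrite -subr_eq0 -[X in _ == X]H.
    by rewrite /c /= scaleNr addrC mulrC mulrA mulrAC.
  move=> y; rewrite in_cons dualDE dualZE => /predU1P[->|ys].
    by rewrite mulNr divfK// addNr.
  by rewrite (f0s y ys) (fs y ys) mulr0 addr0.
exists (c *: x + y) => f; rewrite linearP/= -yE.
by rewrite -[c *: _]/(c * _) addrC subrK.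
Qed.

(** Otherwise [phi] has norm at most [1 - e] on the annihilator of [s]. Extending this restriction
    with the same bound gives [psi], and [phi - psi], zero on the annihilator, is an evaluation too
    close to [phi]. *)
Lemma helly_annihilator (X : normedModType R) (phi : dual (dual X)) (e : R) (s : seq X) :
  e < 1 -> (forall x, ~ (forall f : dual X, `|phi f - f x| <= (1 - e) * `|f|)) ->
  exists f : dual X, [/\ `|f| <= 1, forall x, x \in s -> f x = 0 & 1 - e < phi f].
Proof.
move=> e1 phix; apply: contrapT => Hf.
have e1' : 0 <= 1 - e by rewrite subr_ge0 ltW.
pose G : set (dual X * R) := [set (f, phi f) |
  f in [set f : dual X | forall x, x \in s -> f x = 0]].
have [||_ [f /= fs <-]|psi [psil psip psiG]] :=
    hahn_banach (G := G) (@sublinear_norm R (dual X) (1 - e) e1').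
- by exists 0 => //; rewrite linear0.
- move=> t _ _ [f /= fs <-] [g /= gs <-]; exists (t *: f + g); last by rewrite linearP.
  by move=> x xs; rewrite dualDE dualZE fs// gs// mulr0 addr0.
- rewrite /= leNgt; apply/negP => phif; apply: Hf.
  have f0 : 0 < `|f|.
    rewrite normr_gt0; apply: contraTneq phif => ->.
    by rewrite linear0 normr0 mulr0 ltxx.
  exists (`|f|^-1 *: f); split.
  + by rewrite normrZ normfV normr_id mulVf ?gt_eqF.
  + by move=> x xs; rewrite dualZE fs// mulr0.
  + by rewrite linearZ /= -[_ *: _]/(_ * _) ltr_pdivlMl// mulrC.
have [|f fs|x xE] := @annihilator_span X s (fun f => phi f - psi f).
- move=> t f g; rewrite linearP/= psil scalerBr opprD addrACA//.
- by rewrite (psiG (f, phi f)) ?subrr//; exists f.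
apply: (phix x) => f; rewrite -xE subKr ler_norml psip andbT lerNl.
have := psil (- 1) f 0; have := psil (- 1) 0 0.
rewrite !scaleN1r !addr0 oppr0 => p0; rewrite p0 addNr addr0 => <-.
by rewrite -normrN; exact: psip.
Qed.

(* Minimax: a functional which is at most [c] on the intersection of the balls
   [|x i + z| <= 1 + eps] splits accordingly. *)
Lemma split_functional (X : normedModType R) (m : nat) (x : 'I_m -> X)
    (eps c : R) (f : dual X) : 0 < eps -> 0 < c -> (forall i, `|x i| <= 1) ->
  (forall z, (forall i, `|x i + z| <= 1 + eps) -> f z <= c) ->
  exists phi : 'I_m -> dual X, \sum_i phi i = f /\
    (1 + eps) * \sum_i `|phi i| <= c + \sum_i phi i (x i).
Proof.
move=> eps0 c0 x1 fc.
(* The infimum [q] of [S y] is the gauge of the families [y] with [|x i + y i| <= 1 + eps] for all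
   [i]; this set contains the ball of radius [eps], so the gauge is finite. *)
pose S (y : 'I_m -> X) := [set r | 0 < r /\ forall i, `|r *: x i + y i| <= (1 + eps) * r].
have Sbig y r : 0 < r -> (forall i, `|y i| <= eps * r) -> S y r.
  move=> r0 yr; split=> // i; rewrite (le_trans (ler_normD _ _))// mulrDl mul1r.
  by rewrite lerD// normrZ gtr0_norm// ler_piMr// ltW.
have Sinf y : has_inf (S y).
  split; last by exists 0 => r [/ltW].
  exists ((\sum_i `|y i|) / eps + 1); apply: (Sbig).
    by apply: ltr_wpDl => //; apply: divr_ge0; [exact: sumr_ge0|exact: ltW].
  move=> i; rewrite mulrDr mulr1 mulrCA divff ?gt_eqF// mulr1.
  rewrite (bigD1 i)//= -addrA lerDl; apply: addr_ge0; last exact: ltW.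
  exact: sumr_ge0.
pose q y := inf (S y).
have qle : forall y r, S y r -> q y <= r.
  by move=> y r Syr; apply: ge_inf => //; case: (Sinf y).
have leq_q y r : (forall t, S y t -> r <= t) -> r <= q y.
  by move=> H; apply: lb_le_inf => //; case: (Sinf y).
have q0 : q 0 = 0.
  apply/le_anti/andP; split; last by apply: (leq_q) => t [/ltW].
  apply/ler_addgt0Pl => r r0; rewrite addr0; apply: (qle); apply: (Sbig) => // i.
  by rewrite normr0 mulr_ge0// ltW.
have qZ t y : 0 < t -> q (t *: y) <= t * q y.
  move=> t0; rewrite -ler_pdivrMl//; apply: (leq_q) => r [r0 yr].
  rewrite ler_pdivrMl//; apply: (qle); split=> [|i]; first exact: mulr_gt0.
  rewrite -scalerA -[(t *: y) i]/(t *: y i) -scalerDr normrZ gtr0_norm// mulrCA.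
  by rewrite ler_pM2l.
have sq : sublinear q.
  split=> [y z|t y].
    suff : q (y + z) - q z <= q y by rewrite lerBlDr.
    apply: (leq_q) => r [r0 yr]; suff : q (y + z) - r <= q z by lra.
    apply: (leq_q) => t [t0 zt]; rewrite lerBlDr; apply: (qle); split=> [|i].
      exact: addr_gt0.
    rewrite scalerDl -[(y + z) i]/(y i + z i) [y i + _]addrC addrACA mulrDr.
    by rewrite (le_trans (ler_normD _ _))// lerD.
  rewrite le_eqVlt => /predU1P[<-|t0]; first by rewrite scale0r mul0r q0.
  apply/le_anti; rewrite qZ//= -ler_pdivlMl//.
  by rewrite -{1}[y]scale1r -(mulVf (lt0r_neq0 t0)) -scalerA qZ// invr_gt0.
have scq : sublinear (fun y => c * q y).
  split=> [y z|t y t0]; first by rewrite -mulrDr ler_pM2l// sq.1.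
  by rewrite sq.2// mulrCA.
(* [f] is extended from the diagonal to the whole product, dominated by [c * q]; the components of
   the extension are the required [phi i]. *)
pose G : set (('I_m -> X) * R) := [set ((fun=> z), f z) | z in [set: X]].
have [||_ [z _ <-]|Phi0 [Phi0l Phi0p Phi0G]] := hahn_banach (G := G) scq.
- by exists 0; rewrite // linear0.
- by move=> t _ _ [z _ <-] [z' _ <-]; exists (t *: z + z'); rewrite // linearP.
- rewrite /= -ler_pdivrMl//; apply: (leq_q) => r [r0 zr].
  rewrite ler_pdivrMl// mulrC -ler_pdivrMl//.
  have := fc (r^-1 *: z); rewrite linearZ/=; apply => i.
  rewrite -(ler_pM2l r0) -{1}(gtr0_norm r0) -normrZ scalerDr scalerA.
  by rewrite divff ?gt_eqF// scale1r [r * _]mulrC; exact: zr.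
have [Phi PhiE] := linear_exists (Phi0l : linear (Phi0 : _ -> R^o)).
pose del i (z : X) : 'I_m -> X := fun j => if j == i then z else 0.
have dell i a z z' : del i (a *: z + z') = a *: del i z + del i z'.
  by apply/funext => j; rewrite /del !fctE; case: ifP => // _; rewrite scaler0 addr0.
have /choice[phi phiE] : forall i, exists g : dual X, forall z, g z = Phi (del i z).
  move=> i; have [|||g [_ gE]] := @dual_of_linear R X (fun z => Phi (del i z)) (c / eps).
  - by rewrite divr_ge0// ltW.
  - by move=> a z z'; rewrite dell linearP.
  - move=> z; rewrite PhiE (le_trans (Phi0p _))// -mulrA ler_pM2l//.
    have [->|z0] := eqVneq z 0.
      have -> : del i 0 = 0 by apply/funext => j; rewrite /del; case: ifP.
      by rewrite q0 normr0 mulr0.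
    apply: (qle); apply: (Sbig); first by rewrite mulr_gt0 ?invr_gt0 ?normr_gt0.
    move=> j; rewrite mulrA divff ?gt_eqF// mul1r /del.
    by case: ifP; rewrite ?normr0.
  by exists g.
have PhiS y : Phi y = \sum_i phi i (y i).
  under eq_bigr do rewrite phiE; rewrite -linear_sum; congr (Phi _).
  apply/funext => j; rewrite fct_sumE (bigD1 j)//= /del eqxx big1 ?addr0// => i ij.
  by rewrite eq_sym (negPf ij).
have dual_sumE (z : X) : (\sum_i phi i) z = \sum_i phi i z.
  by rewrite (@big_morph _ _ (fun f : dual X => f z) 0 +%R).
exists phi; split.
  apply: dualP => z; rewrite dual_sumE -(PhiS (fun=> z)) PhiE.
  by apply: (Phi0G (_, _)); exists z.
apply/ler_addgt0Pl => r r0.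
have r'0 : 0 < r / (1 + eps) / (m%:R + 1) by rewrite !divr_gt0// ?ltr_wpDl// ltW.
(* With [b i] almost norming [phi i], the family [(1 + eps) *: b i - x i] has gauge at most 1, and
   testing the extension there gives the bound. *)
have /choice[b bP] : forall i, exists b, `|b| <= 1 /\
    `|phi i| - r / (1 + eps) / (m%:R + 1) <= phi i b.
  by move=> i; have [b b1 bi] := dual_norm_approx (phi i) r'0; exists b.
have : \sum_i phi i ((1 + eps) *: b i - x i) <= c.
  rewrite -(PhiS (fun i => (1 + eps) *: b i - x i)) PhiE (le_trans (Phi0p _))//.
  rewrite ger_pMr//; apply: (qle); split=> // i; rewrite scale1r addrC subrK mulr1.
  rewrite normrZ gtr0_norm; last by rewrite addr_gt0.
  by rewrite ler_piMr ?(bP i).1// addr_ge0// ltW.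
have -> : \sum_i phi i ((1 + eps) *: b i - x i) =
    (1 + eps) * (\sum_i phi i (b i)) - \sum_i phi i (x i).
  by rewrite mulr_sumr -sumrB; apply: eq_bigr => i _; rewrite linearB linearZ.
have : \sum_i `|phi i| - r / (1 + eps) <= \sum_i phi i (b i).
  apply: (@le_trans _ _ (\sum_i (`|phi i| - r / (1 + eps) / (m%:R + 1)))).
    have : 0 <= r / (1 + eps) by rewrite divr_ge0 ?addr_ge0 ?(ltW r0) ?(ltW eps0).
    rewrite sumrB lerD2l lerN2 sumr_const card_ord.
    move: (r / (1 + eps)) => k k0.
    by rewrite -[X in X <= _]mulr_natr mulrAC ler_pdivrMr ?ltr_wpDl// ler_wpM2l// lerDl.
  by apply: ler_sum => i _; exact: (bP i).2.
have e10 : 0 < 1 + eps by rewrite addr_gt0.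
rewrite -(ler_pM2l e10) mulrBr mulrCA divff ?gt_eqF// mulr1; lra.
Qed.

End nonreflexive.

(** * Under property (M-star), nonreflexive spaces are [c0_like] *)

Section Mstar_nonreflexive.
Context {R : realType} (X : completeNormedModType R).
Hypotheses (sepX : separable_space X) (MstarX : property_Mstar X).

(* By property (M-star) [u] may be replaced by a vector of the same norm that is
   almost normed by [phi]. *)
Lemma Mstar_bidual_lower (phi : dual (dual X)) (w : nat -> dual X) (B : R)
    (u : dual X) (eta : R) : `|phi| = 1 -> weak_star_null w ->
  (forall n, `|w n| <= B) -> 0 < eta ->
  \forall n \near \oo, `|u| + phi (w n) - eta <= `|u + w n|.
Proof.
move=> phi1 w0 wB eta0; apply: contrapT => /not_near_subseq[s [ns ws]].
have phile g : phi g <= `|g|.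
  rewrite (le_trans (ler_norm _))// (le_trans (ler_dual_norm _ _))//.
  by rewrite -dual_normE phi1 mul1r.
have phiB n : `|phi (w (s n))| <= B.
  rewrite (le_trans (ler_dual_norm _ _))// -dual_normE phi1 mul1r//; exact: wB.
(* Property (M-star) compares eventual bounds by a constant, so [phi (w n)] is first made to
   converge. *)
have [|t [nt [L /(_ tt) phiL]]] :=
    @diagonal_subsequence R unit (fun _ n => phi (w (s n))).
  by move=> _; exists B.
set a := L tt in phiL.
have nst n : (n <= s (t n))%N by exact: leq_trans (nt n) (ns _).
have e8 : 0 < eta / 8 by rewrite divr_gt0.
have wst0 : weak_star_null (fun n => w (s (t n))).
  by move=> x; exact: (cvg_subseq nst (w0 x)).
have wu : \forall n \near \oo, `|w (s (t n)) + u| <= `|u| + a - eta + eta / 8.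
  have := near_cvg_dist e8 phiL; apply: filterS => n.
  have := ws (t n); rewrite addrC ler_norml => /negP; rewrite -ltNge [u + _]addrC; lra.
have e'0 : 0 < eta / 8 / (`|u| + 1) by rewrite !divr_gt0// ltr_wpDl.
have [v v1 phiv] := dual_norm_approx phi e'0.
have uv : `| `|u| *: v| <= `|u| by rewrite normrZ normr_id ler_piMr.
have wv := Mstar_near MstarX wst0 uv wu e8.
near \oo => n.
have H1 : `|w (s (t n)) + `|u| *: v| <= `|u| + a - eta + eta / 8 + eta / 8 by near: n.
have H2 : `|a - phi (w (s (t n)))| <= eta / 8 by near: n; exact: near_cvg_dist.
have H3 := phile (w (s (t n)) + `|u| *: v).
have H4 : phi (w (s (t n)) + `|u| *: v) = phi (w (s (t n))) + `|u| * phi v.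
  by rewrite linearD linearZ.
have H5 : `|u| - eta / 8 <= `|u| * phi v.
  have : `|u| * (`|phi| - eta / 8 / (`|u| + 1)) <= `|u| * phi v by rewrite ler_wpM2l.
  apply: le_trans.
  rewrite phi1 mulrBr mulr1 lerD2l lerN2 mulrA ler_pdivrMr ?ltr_wpDl//.
  by rewrite mulrC ler_pM2l// lerDl.
move: H2; rewrite ler_norml; lra.
Unshelve. all: by end_near. Qed.

(** If no [z] exists, every [f n] is at most [1 - eps] on the intersection of balls and splits into
    pieces [psi n i]. In the weak-star limit the pieces become [u i] plus weak-star null parts
    summing to [f n]; the l_1-behaviour of the norm makes them too long for the splitting bound. *)
Lemma nonreflexive_c0_like : ~ reflexive_space X -> c0_like X.
Proof.
move=> nrX s eps eps0 s1.
have [eps1|eps1] := lerP 1 eps.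
  exists 0 => [|x xs]; first by rewrite normr0 subr_le0.
  by rewrite addr0 (le_trans (s1 x xs))// lerDl ltW.
apply: contrapT => Hz.
have e01 : 0 < eps / 4 < 1 by rewrite divr_gt0//=; lra.
have [phi [phi1 phi_dist]] := nonreflexive_riesz nrX e01.
have [d dX] := separable_dense_seq sepX.
have /choice[f fP] : forall n, exists f : dual X, [/\ `|f| <= 1,
    forall x, x \in mkseq d n -> f x = 0 & 1 - eps / 4 < phi f].
  by move=> n; apply: helly_annihilator => //; case/andP: e01.
have f0 : weak_star_null f.
  move=> x; apply/cvgrPdist_lt => e e0; have [k xk] := dX x e e0.
  exists k.+1 => // n /= kn; rewrite sub0r normrN.
  have [f1 fd _] := fP n; have fdk : f n (d k) = 0 by apply: fd; rewrite map_f// mem_iota.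
  rewrite -[f n x]subr0 -fdk -linearB (le_lt_trans (ler_dual_norm _ _))//.
  by rewrite (le_lt_trans _ xk)// ler_piMl.
pose m := size s; pose x (i : 'I_m) := nth 0 s i.
have xs i : x i \in s by exact: mem_nth.
have c0 : 0 < 1 - eps by rewrite subr_gt0.
have /choice[psi psiP] : forall n, exists psi : 'I_m -> dual X, \sum_i psi i = f n /\
    (1 + eps) * \sum_i `|psi i| <= 1 - eps + \sum_i psi i (x i).
  move=> n; apply: split_functional => // [i|z zx]; first exact: s1.
  rewrite leNgt; apply/negP => fz; apply: Hz; exists z.
    have [f1 _ _] := fP n; rewrite (le_trans (ltW fz))//.
    by rewrite (le_trans (ler_norm _))// (le_trans (ler_dual_norm _ _))// ler_piMl.
  by move=> y /(nthP 0)[i im <-]; exact: (zx (Ordinal im)).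
have psi_x n : \sum_i psi n i (x i) <= \sum_i `|psi n i|.
  apply: ler_sum => i _; rewrite (le_trans (ler_norm _))//.
  by rewrite (le_trans (ler_dual_norm _ _))// ler_piMr ?dual_norm_ge0 ?s1.
have psiB i n : `|psi n i| <= (1 - eps) / eps.
  rewrite ler_pdivlMr// mulrC (@le_trans _ _ (eps * \sum_i `|psi n i|))//.
    by rewrite ler_pM2l// (bigD1 i)//= lerDl sumr_ge0.
  by have := (psiP n).2; have := psi_x n; lra.
have [|t [u [nt psiu]]] := separable_alaoglu (f := fun i n => psi n i) sepX.
  by move=> i; exists ((1 - eps) / eps) => n; exact: psiB.
have dual_sumE (g : 'I_m -> dual X) z : (\sum_i g i) z = \sum_i g i z.
  by rewrite (@big_morph _ _ (fun f : dual X => f z) 0 +%R).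
(* The pieces sum to the weak-star null [f n], so the limits cancel and the null parts alone carry
   [phi (f (t n))]. *)
have u0 : \sum_i u i = 0.
  apply: dualP => z; rewrite dual_sumE.
  have H1 : \sum_i psi (t n) i z @[n --> \oo] --> \sum_i u i z.
    by apply: cvg_big => [|i _]; [exact: add_continuous|exact: psiu].
  have H2 := cvg_subseq nt (f0 z).
  apply: (cvg_unique (@norm_hausdorff _ R) H1).
  rewrite (_ : (fun n => _) = (fun n => f (t n) z)); first exact: H2.
  by apply/funext => n; rewrite -(psiP (t n)).1 dual_sumE.
pose w i n := psi (t n) i - u i.
have w0 i : weak_star_null (w i).
  move=> z; rewrite -(subrr (u i z : R^o)).
  by apply: cvgB; [exact: psiu|exact: cvg_cst].
have eta0 : 0 < eps / 4 / (m%:R + 1) by rewrite !divr_gt0// ltr_wpDl.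
set eta := _ / _ in eta0.
have m_eta : m%:R * eta <= eps / 4.
  rewrite /eta mulrA ler_pdivrMr ?ltr_wpDl// mulrC ler_pM2l ?divr_gt0//.
  by rewrite lerDl.
have lower i : \forall n \near \oo, `|u i| + phi (w i n) - eta <= `|psi (t n) i|.
  have wB n : `|w i n| <= (1 - eps) / eps + `|u i|.
    by rewrite (le_trans (ler_normB _ _))// lerD2r psiB.
  have := Mstar_bidual_lower (u i) phi1 (w0 i) wB eta0.
  by apply: filterS => n; rewrite [u i + _]addrC subrK.
have upper i : \forall n \near \oo, psi (t n) i (x i) <= `|u i| + eta.
  have := near_cvg_dist eta0 (psiu i (x i)); apply: filterS => n.
  have : u i (x i) <= `|u i|.
    rewrite (le_trans (ler_norm _))// (le_trans (ler_dual_norm _ _))//.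
    by rewrite ler_piMr ?dual_norm_ge0 ?s1.
  rewrite ler_norml; lra.
have lowers := near_seq (s := enum 'I_m) (fun i _ => lower i).
have uppers := near_seq (s := enum 'I_m) (fun i _ => upper i).
near \oo => n.
have Hl i : `|u i| + phi (w i n) - eta <= `|psi (t n) i|.
  by have := mem_enum 'I_m i; move: i; near: n.
have Hu i : psi (t n) i (x i) <= `|u i| + eta.
  by have := mem_enum 'I_m i; move: i; near: n.
have H1 := ler_sum (index_enum 'I_m) (fun i (_ : true) => Hl i).
have H2 := ler_sum (index_enum 'I_m) (fun i (_ : true) => Hu i).
have H3 : \sum_i phi (w i n) = phi (f (t n)).
  rewrite -linear_sum; congr (phi _).
  by rewrite sumrB u0 subr0 (psiP (t n)).1.
have [_ _ H4] := fP (t n).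
have H5 := (psiP (t n)).2.
have H6 : 0 <= eps * \sum_i `|psi (t n) i| by rewrite mulr_ge0 ?sumr_ge0// ltW.
have sum_eta : \sum_(i < m) eta = m%:R * eta by rewrite sumr_const card_ord mulr_natl.
(* The lower bound exceeds [sum |u i| + 1 - eps / 2], while the splitting allows at most
   [sum |u i| + 1 - 3 * eps / 4]. *)
move: H1 H2; rewrite sumrB !big_split/= H3 sum_eta.
move: H5; rewrite mulrDl mul1r; lra.
Unshelve. all: by end_near. Qed.

End Mstar_nonreflexive.

Theorem proposition3p7 (R : realType) (X : completeNormedModType R)
    (sepX : separable_space X) (MstarX : property_Mstar X) :
  [<-> reflexive_space X;
       ~ contains_isomorphic_copy (ell1 R) (dual X);
       ~ contains_isomorphic_copy (c0 R) X;
       fixed_point_property X;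
       fixed_point_property (dual X)].
Proof.
have refl_no_c0_like (Y : completeNormedModType R) : weakly_seq_compact Y -> ~ c0_like Y.
  move=> wY /c0_like_basic[y yP]; apply: (weakly_seq_compact_no_c0 wY).
  exact: c0_basic_copy yP.
have fpp (Y : completeNormedModType R) : weakly_seq_compact Y -> property_M Y ->
    fixed_point_property Y.
  by move=> wY MY; apply: fpp_of_property_M => //; exact: refl_no_c0_like.
have refl (P : Prop) : (~ reflexive_space X -> ~ P) -> P -> reflexive_space X.
  by move=> nP p; apply: contrapT => /nP.
(* One such sequence refutes each of the four other conditions, directly in [X] or through its
   norming functionals in the dual. *)
have nrefl : ~ reflexive_space X -> exists y : nat -> X, c0_basic y.
  by move=> /(nonreflexive_c0_like sepX MstarX)/c0_like_basic.
have ell1_refl : ~ contains_isomorphic_copy (ell1 R) (dual X) -> reflexive_space X.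
  apply: refl => /nrefl[y /c0_basic_dual[g gP]]; apply.
  exact: ell1_basic_copy gP.
have c0_refl : ~ contains_isomorphic_copy (c0 R) X -> reflexive_space X.
  by apply: refl => /nrefl[y yP]; apply; exact: c0_basic_copy yP.
have fpp_refl : fixed_point_property X -> reflexive_space X.
  by apply: refl => /nrefl[y yP]; exact: c0_basic_no_fpp yP.
have fpp_dual_refl : fixed_point_property (dual X) -> reflexive_space X.
  by apply: refl => /nrefl[y /c0_basic_dual[g gP]]; exact: ell1_basic_no_fpp gP.
(* Every link of the cycle first returns to reflexivity and then derives the next condition from
   it. *)
tfae.
- by move=> rX; apply: weakly_seq_compact_no_ell1; exact: dual_weakly_seq_compact.
- move=> /ell1_refl rX.
  by apply: weakly_seq_compact_no_c0; exact: reflexive_weakly_seq_compact.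
- move=> /c0_refl rX; apply: fpp; first exact: reflexive_weakly_seq_compact.
  exact: Mstar_property_M.
- move=> /fpp_refl rX; apply: (fpp (dual X)); first exact: dual_weakly_seq_compact.
  exact: Mstar_dual_property_M.
- exact: fpp_dual_refl.
Qed.
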